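(* Let $K$ be a field containing $\mathbb{C}$. There exists an AS-Ore extension $A$ over $K$ with $2$ degree one generators whose Hilbert series is $$h_A(t)=\frac{1}{(1-t)^2(1-t^2)(1-t^3)(1-t^5)}$$ and whose relation type is $(3,4,7)$.
   Context: Let $K$ be a field. For a ring $R$, a ring endomorphism $\sigma$ of $R$ and a $\sigma$-derivation $\delta$ of $R$ (i.e. $\delta$ is additive and $\delta(r_1r_2)=\sigma(r_1)\delta(r_2)+\delta(r_1)r_2$), the Ore extension $R[x,\sigma,\delta]$ is the ring whose elements are written uniquely as $\sum_{i=0}^m a_ix^i$ with $a_i\in R$, with multiplication satisfying $xr=\sigma(r)x+\delta(r)$ for $r\in R$. A graded iterated Ore extension over $K$ in $n$ variables is a $K$-algebra (so $K$ is central) $A=K[x_1][x_2,\sigma_2,\delta_2]\cdots[x_n,\sigma_n,\delta_n]$ obtained by iterating this construction, where $\sigma_j$ and $\delta_j$ are a ($K$-linear) endomorphism and a ($K$-linear) $\sigma_j$-derivation of $K_{(j-1)}:=K[x_1][x_2,\sigma_2,\delta_2]\cdots[x_{j-1},\sigma_{j-1},\delta_{j-1}]$, together with integers $\deg(x_i)\ge 1$ such that for all $j>i$, $\sigma_j(x_i)$ is homogeneous of degree $\deg(x_i)$ and $\delta_j(x_i)$ is homogeneous of degree $\deg(x_j)+\deg(x_i)$ (with $0$ homogeneous of every degree). Such $A$ is $\mathbb{N}$-graded and connected. An AS-Ore extension is a graded iterated Ore extension in which every $\sigma_j$ is injective and which is generated in degree one as a $K$-algebra. Its number of degree one generators is $b=\dim_K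 A_1$. The Hilbert series of $A=\bigoplus_m A_m$ is $h_A(t)=\sum_m(\dim_K A_m)t^m$. Relation type: write $A\cong K\langle y_1,\dots,y_b\rangle/I$ with all $y_i$ of degree one, $b=\dim_K A_1$, and $I$ a homogeneous two-sided ideal. The relation type of $A$ is the list $(a_1,\dots,a_n)$, $a_1\le\cdots\le a_n$, of the degrees of the elements of a minimal homogeneous generating set of $I$ (independent of choices). *)

(* Defs.v *)
From HB Require Import structures.
From mathcomp Require Import all_boot all_algebra.
From mathcomp Require Import monalg.

Set Implicit Arguments.
Unset Strict Implicit.
Unset Printing Implicit Defensive.

Import GRing.Theory.
Local Open Scope ring_scope.

Section OreExtension.
Variables (K : fieldType) (R S : algType K).

Definition is_sigma_derivation (sigma delta : R -> R) : Prop :=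
  forall r1 r2, delta (r1 * r2) = sigma r1 * delta r2 + delta r1 * r2.

(* S, with the inclusion iota of R, is R[x, sigma, delta].  A finite family of
   coefficients (a_i) is encoded as a {poly R}; only its coefficients are
   used, not its ring structure.  Injectivity of iota follows from the
   uniqueness for constant families. *)
Definition is_ore_extension (iota : {lrmorphism R -> S})
    (sigma : {lrmorphism R -> R}) (delta : {linear R -> R}) (x : S) : Prop :=
  [/\ is_sigma_derivation sigma delta,
      forall s, exists! p : {poly R},
        s = \sum_(i < size p) iota p`_i * x ^+ i
    & forall r, x * iota r = iota (sigma r) * x + iota (delta r)].

End OreExtension.

Section Grading.
Variables (K : fieldType) (A : algType K) (n : nat).
(* tnth gens i is the pair (x_i, deg x_i). *)
Variable gens : n.-tuple (A * nat).

Definition monomial (e : 'I_n -> nat) : A :=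
  \prod_(i < n) (tnth gens i).1 ^+ e i.

Definition monomial_degree (e : 'I_n -> nat) : nat :=
  (\sum_(i < n) e i * (tnth gens i).2)%N.

(* a lies in A_m, the span of the ordered monomials of degree m.  The bound
   e i <= m on the exponents loses nothing since all deg x_i are >= 1. *)
Definition homogeneous (m : nat) (a : A) : Prop :=
  exists c : {ffun 'I_n -> 'I_m.+1} -> K,
    a = \sum_(e : {ffun 'I_n -> 'I_m.+1} |
                  monomial_degree (fun i => e i) == m)
          c e *: monomial (fun i => e i).

Definition generated_in_degree_one : Prop :=
  forall P : A -> Prop,
    (forall a, homogeneous 1 a -> P a) ->
    P 1 ->
    (forall (c : K) a b, P a -> P b -> P (c *: a + b)) ->
    (forall a b, P a -> P b -> P (a * b)) ->
  forall a, P a.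

End Grading.

(* K^o is K as an algebra over itself.  The K-linearity of sigma and delta
   forces the first step of the iteration to be K[x_1, id, 0] = K[x_1]. *)
Inductive graded_iterated_ore (K : fieldType) :
    forall (A : algType K) (n : nat), n.-tuple (A * nat) -> Type :=
| Ore_base : @graded_iterated_ore K K^o 0 [tuple]
| Ore_step (B A : algType K) (n : nat) (gens : n.-tuple (B * nat))
    (iota : {lrmorphism B -> A}) (sigma : {lrmorphism B -> B})
    (delta : {linear B -> B}) (x : A) (d : nat) :
    graded_iterated_ore gens ->
    is_ore_extension iota sigma delta x ->
    (1 <= d)%N ->
    (forall i : 'I_n,
       homogeneous gens (tnth gens i).2 (sigma (tnth gens i).1)) ->
    (forall i : 'I_n,
       homogeneous gens (d + (tnth gens i).2)%N (delta (tnth gens i).1)) ->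
    graded_iterated_ore
      [tuple of rcons [tuple of [seq (iota g.1, g.2) | g <- gens]] (x, d)].

Fixpoint sigmas_injective (K : fieldType) (A : algType K) (n : nat)
    (gens : n.-tuple (A * nat)) (T : graded_iterated_ore gens) : Prop :=
  match T with
  | Ore_base => True
  | Ore_step _ _ _ _ _ sigma _ _ _ T' _ _ _ _ =>
      sigmas_injective T' /\ injective sigma
  end.

Definition AS_Ore_extension (K : fieldType) (A : algType K) (n : nat)
    (gens : n.-tuple (A * nat)) : Prop :=
  (exists T : graded_iterated_ore gens, sigmas_injective T)
  /\ generated_in_degree_one gens.

(* The subspace V of E has dimension d: it has a basis of d vectors. *)
Definition has_dim (K : fieldType) (E : lmodType K) (V : E -> Prop)
    (d : nat) : Prop :=
  exists v : 'I_d -> E,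
    (forall c : 'I_d -> K, \sum_i c i *: v i = 0 -> forall i, c i = 0)
    /\ (forall u, V u <-> exists c : 'I_d -> K, u = \sum_i c i *: v i).

(* The Hilbert series is 1 / q in Z[[t]], i.e., h_A(t) * q(t) = 1, where the
   left-hand side is computed as a Cauchy product. *)
Definition hilbert_series_is_inv (K : fieldType) (A : algType K) (n : nat)
    (gens : n.-tuple (A * nat)) (q : {poly int}) : Prop :=
  exists h : nat -> nat,
    (forall m, has_dim (homogeneous gens m) (h m))
    /\ (forall m, \sum_(i < m.+1) q`_i * (h (m - i)%N)%:Z = (m == 0%N)%:R).

(* K<y_1, ..., y_b>: the algebra of the free monoid on 'I_b. *)
Notation free_algebra K b := {malg K[{fmonom 'I_b}]}.

Definition free_homogeneous (K : fieldType) (b m : nat)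
    (f : free_algebra K b) : Prop :=
  forall w : {fmonom 'I_b}, f@_w != 0 -> fdeg w = m.

Definition is_two_sided_ideal (F : nzRingType) (I : F -> Prop) : Prop :=
  [/\ I 0, forall f g, I f -> I g -> I (f + g)
    & forall u f v, I f -> I (u * f * v)].

Definition ideal_generated_by (F : nzRingType) (G : F -> Prop) (f : F) : Prop :=
  forall I : F -> Prop,
    is_two_sided_ideal I -> (forall g, G g -> I g) -> I f.

Definition is_minimal_generating_family (F : nzRingType) (I : F -> Prop)
    (k : nat) (r : 'I_k -> F) : Prop :=
  let generates (J : {set 'I_k}) :=
    forall f, ideal_generated_by (fun g => exists2 j, j \in J & g = r j) f
              <-> I f in
  generates [set: 'I_k] /\ (forall J, generates J -> J = [set: 'I_k]).

(* The isomorphism of A with K<y_1, ..., y_b> / I is given as a surjection phi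
   with kernel I. *)
Definition relation_type (K : fieldType) (A : algType K) (n : nat)
    (gens : n.-tuple (A * nat)) (a : seq nat) : Prop :=
  sorted leq a /\
  exists (b : nat) (phi : {lrmorphism free_algebra K b -> A})
         (r : 'I_(size a) -> free_algebra K b),
    [/\ has_dim (homogeneous gens 1) b,
        forall i, homogeneous gens 1 (phi << fmu i >>),
        forall z, exists f, phi f = z,
        forall j : 'I_(size a), free_homogeneous (nth 0%N a j) (r j)
      & is_minimal_generating_family (fun f => phi f = 0) r].

(* Main.v *)
Require Import Defs.
From HB Require Import structures.
From mathcomp Require Import all_boot all_algebra.
From mathcomp Require Import finmap monalg.
From mathcomp Require Import zify ring.
From mathcomp Require Import boolp reals complex.

Set Implicit Arguments.
Unset Strict Implicit.
Unset Printing Implicit Defensive.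

Import GRing.Theory.
Local Open Scope ring_scope.

(**
Let u be a primitive sixth root of unity, so that u^2 = u - 1. The algebra A is
the iterated Ore extension in y, w, v, z, x, adjoined in this order and of
degrees 1, 3, 5, 2, 1, with
  [w y = u^2 y w,   v y = u^2 y v - w^2,   v w = u^2 w v],
  [z y = y z + w,   z w = u w z + v,       z v = u^2 v z],
  [x y = - u y x + z,  x w = - u^2 w x + u^2 z^2,  x v = v x,  x z = u z x].
Every sigma is diagonal in the variables with eigenvalues sixth roots of unity,
hence injective, and z, w, v are iterated skew commutators of x and y, with
leading words xy, xyy, xyxyy, so A is generated by x and y in degree one. The
scalars come from an ansatz graded by Z^2, with one skew commutation rule for each
pair of variables: the overlap conditions force the eigenvalue of sigma_x at z
divided by that of sigma_z at y to be a root of t^2 - t + 1.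

To build one Ore step one needs sigma and delta on the previous ring. A pair
(sigma, delta) is the same thing as a homomorphism a |-> (sigma a, delta a; 0, a)
into triangular matrices, so it can be produced by the universal property of the
previous step: only the relations between the triangular matrices attached to
the generators have to be checked (ore_tower_step, and ore_tower_y to
ore_tower_x). A step of degree d divides the Hilbert series by 1 - t^d because
homogeneous elements split uniquely as b + c x (homogeneous_oreP).

For the relation type, put z = xy + u yx, w = zy - yz, v = zw - u wz in the free
algebra. The relators x z - u z x, w y - u^2 y w and z v - u^2 v z, of degrees
3, 4 and 7, imply all ten relations (three_relations): x w and x v are computed
from the definitions of w and v, v y from z (w y), and v w from z (v y). Hence by
the universal property of A the quotient of the free algebra by any ideal
containing the three relators receives a map from A, so they generate the kernel
of the projection to A. None is redundant, since for each of them there are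
small matrices x, y that violate it and satisfy the other two (separate3,
separate4, separate7).
*)

(** * Ore extensions as algebras of skew polynomials *)

Section SkewEvaluation.
Variables (K : fieldType) (R S : algType K) (f : {linear R -> S}) (X : S).

(** The value at X of a polynomial with coefficients on the left; {poly R} only
serves as a type of finitely supported coefficient sequences. *)
Definition skeval (p : {poly R}) : S := \sum_(i < size p) f p`_i * X ^+ i.

Lemma skeval_widen n (p : {poly R}) :
  (size p <= n)%N -> skeval p = \sum_(i < n) f p`_i * X ^+ i.
Proof.
move=> lepn; rewrite /skeval (big_ord_widen n (fun i => f p`_i * X ^+ i)) //.
rewrite big_mkcond; apply: eq_bigr => i _; case: ifP => // /negbT.
by rewrite -leqNgt => ?; rewrite nth_default // linear0 mul0r.
Qed.

Lemma skevalD p q : skeval (p + q) = skeval p + skeval q.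
Proof.
pose n := maxn (size p) (size q).
rewrite !(@skeval_widen n) ?leq_maxl ?leq_maxr ?size_polyD //.
by rewrite -big_split; apply: eq_bigr => i _; rewrite coefD linearD mulrDl.
Qed.

Lemma skevalC c : skeval c%:P = f c.
Proof.
by rewrite (@skeval_widen 1) ?size_polyC_leq1 // big_ord1 coefC mulr1.
Qed.

Lemma skeval0 : skeval 0 = 0.
Proof. by rewrite -[0]/(0%:P) skevalC linear0. Qed.

Lemma skevalMX p : skeval (p * 'X) = skeval p * X.
Proof.
have [->|p0] := eqVneq p 0; first by rewrite mul0r skeval0 mul0r.
rewrite /skeval size_mulX // big_ord_recl coefMX linear0 mul0r add0r.
by rewrite mulr_suml; apply: eq_bigr => i _; rewrite coefMX exprSr mulrA.
Qed.

Lemma skevalZ (k : K) p : skeval (k%:A *: p) = k *: skeval p.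
Proof.
rewrite (@skeval_widen (size p)) ?size_scale_leq // scaler_sumr.
by apply: eq_bigr => i _; rewrite coefZ mulr_algl linearZ scalerAl.
Qed.

End SkewEvaluation.

Section OreModel.
Variables (K : fieldType) (R : algType K).
Variables (s : {lrmorphism R -> R}) (d : {linear R -> R}).
Hypothesis sd : is_sigma_derivation s d.

Lemma derivation1 : d 1 = 0.
Proof.
have := sd 1 1; rewrite !mulr1 rmorph1 mul1r => /eqP.
by rewrite -subr_eq subrr eq_sym => /eqP.
Qed.

Lemma derivation_alg (k : K) : d k%:A = 0.
Proof. by rewrite linearZ /= derivation1 scaler0. Qed.

(** Left multiplication by x on R[x, s, d], as dictated by x r = s(r) x + d(r). *)
Definition x_times (q : {poly R}) : {poly R} := map_poly s q * 'X + map_poly d q.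

Lemma x_times_is_zmod_morphism : zmod_morphism x_times.
Proof.
by move=> p q; rewrite /x_times !raddfB /= mulrBl opprD addrACA.
Qed.
HB.instance Definition _ :=
  GRing.isZmodMorphism.Build {poly R} {poly R} x_times x_times_is_zmod_morphism.

Lemma x_timesD p q : x_times (p + q) = x_times p + x_times q.
Proof. exact: raddfD. Qed.

Lemma x_timesZ c q : x_times (c *: q) = s c *: x_times q + d c *: q.
Proof.
apply/polyP => i; rewrite /x_times !(coefD, coefZ, coef_map, coefMX) /=.
by case: i => [|i] /=; rewrite ?coef_map ?coefZ ?rmorphM ?sd /= ?mulrDr
  ?addrA // add0r ?addr0 ?mulr0 ?add0r.
Qed.

Lemma x_timesZk (k : K) q : x_times (k%:A *: q) = k%:A *: x_times q.
Proof. by rewrite x_timesZ derivation_alg scale0r addr0 rmorph_alg. Qed.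

Lemma x_timesMX q : x_times (q * 'X) = x_times q * 'X.
Proof.
apply/polyP => i; rewrite /x_times !(coefD, coef_map, coefMX) /=.
by case: i => [|[|i]] /=; rewrite ?linear0 ?addr0 ?coef_map ?coefD ?coefMX
  ?coef_map /=.
Qed.

(** The product is p acting on q by left multiplications. Associativity then
reduces to the compatibility of x_times with right multiplication. *)
Definition ore_mul (p q : {poly R}) : {poly R} :=
  \sum_(i < size p) p`_i *: iter i x_times q.

Lemma ore_mul_widen n (p q : {poly R}) :
  (size p <= n)%N -> ore_mul p q = \sum_(i < n) p`_i *: iter i x_times q.
Proof.
move=> lepn; rewrite /ore_mul (big_ord_widen n (fun i => p`_i *: iter i x_times
  q)) //.
rewrite big_mkcond; apply: eq_bigr => i _; case: ifP => // /negbT.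
by rewrite -leqNgt => ?; rewrite nth_default // scale0r.
Qed.

Lemma ore_mulDl : left_distributive ore_mul +%R.
Proof.
move=> p p' q; pose n := maxn (size p) (size p').
rewrite !(@ore_mul_widen n) ?leq_maxl ?leq_maxr ?size_polyD //.
by rewrite -big_split; apply: eq_bigr => i _; rewrite coefD scalerDl.
Qed.

Lemma iter_x_timesD i p q : iter i x_times (p + q) = iter i x_times p + iter i
  x_times q.
Proof. by elim: i => //= i ->; rewrite x_timesD. Qed.

Lemma ore_mulDr : right_distributive ore_mul +%R.
Proof.
move=> p q q'; rewrite /ore_mul -big_split; apply: eq_bigr => i _.
by rewrite iter_x_timesD scalerDr.
Qed.

Lemma ore_mulCl c q : ore_mul c%:P q = c *: q.
Proof. by rewrite (@ore_mul_widen 1) ?size_polyC_leq1 // big_ord1 coefC. Qed.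

Lemma ore_mulMXl p q : ore_mul (p * 'X) q = ore_mul p (x_times q).
Proof.
have [->|p0] := eqVneq p 0.
  by rewrite mul0r /ore_mul size_poly0 !big_ord0.
rewrite /ore_mul size_mulX // big_ord_recl coefMX scale0r add0r.
by apply: eq_bigr => i _; rewrite coefMX iterSr.
Qed.

Lemma ore_mulZl c p q : ore_mul (c *: p) q = c *: ore_mul p q.
Proof.
rewrite (@ore_mul_widen (size p)) ?size_scale_leq // scaler_sumr.
by apply: eq_bigr => i _; rewrite coefZ scalerA.
Qed.

Lemma ore_mulZr (k : K) p q : ore_mul p (k%:A *: q) = k%:A *: ore_mul p q.
Proof.
rewrite /ore_mul scaler_sumr; apply: eq_bigr => i _.
have -> : iter i x_times (k%:A *: q) = k%:A *: iter i x_times q.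
  by elim: (i : nat) => //= j ->; rewrite x_timesZk.
by rewrite !scalerA mulr_algl mulr_algr.
Qed.

(** The heart of associativity: x (p q) = (x p) q, where the derivation law
enters through x_timesZ. *)
Lemma x_times_ore_mul p q : x_times (ore_mul p q) = ore_mul (x_times p) q.
Proof.
elim/poly_ind: p q => [|p c IH] q.
  by rewrite /ore_mul size_poly0 big_ord0 !raddf0 size_poly0 big_ord0.
rewrite ore_mulDl ore_mulMXl ore_mulCl !x_timesD IH x_timesZ x_timesMX.
rewrite ore_mulDl ore_mulMXl; congr (_ + _).
by rewrite /x_times !map_polyC /= ore_mulDl ore_mulMXl !ore_mulCl.
Qed.

Lemma ore_mulA : associative ore_mul.
Proof.
move=> p q r; elim/poly_ind: p q => [|p c IH] q.
  by rewrite /ore_mul !size_poly0 !big_ord0 size_poly0 big_ord0.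
by rewrite !ore_mulDl !ore_mulMXl !ore_mulCl x_times_ore_mul IH ore_mulZl.
Qed.

Lemma ore_mul1l : left_id 1 ore_mul.
Proof. by move=> p; rewrite -[1]/(1%:P) ore_mulCl scale1r. Qed.

Lemma iter_x_times1 i : iter i x_times 1 = 'X^i.
Proof.
elim: i => //= i ->; rewrite /x_times map_polyXn exprSr.
suff -> : map_poly d 'X^i = 0 by rewrite addr0.
apply/polyP => j; rewrite coef_map coefXn coef0.
by case: eqP => _; [exact: derivation1 | exact: linear0].
Qed.

Lemma ore_mul1r : right_id 1 ore_mul.
Proof.
move=> p; rewrite /ore_mul -[RHS]coefK poly_def.
by apply: eq_bigr => i _; rewrite iter_x_times1.
Qed.

(** A copy of {poly R} carrying the skew product; the proof argument keeps the
canonical ring structure attached to a genuine derivation. *)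
Definition ore of is_sigma_derivation s d := {poly R}.
Local Notation S := (ore sd).

HB.instance Definition _ := GRing.Zmodule.copy S {poly R}.
Fact one_neq0 : (1 : {poly R}) != 0 :> S.
Proof. exact: oner_neq0. Qed.
HB.instance Definition _ := GRing.Zmodule_isNzRing.Build S
  ore_mulA ore_mul1l ore_mul1r ore_mulDl ore_mulDr one_neq0.

Definition oscale (k : K) (p : S) : S := k%:A *: (p : {poly R}).
Fact oscaleA k l p : oscale k (oscale l p) = oscale (k * l) p.
Proof. by rewrite /oscale scalerA mulr_algl scalerA. Qed.
Fact oscale1 : left_id 1 oscale.
Proof. by move=> p; rewrite /oscale !scale1r. Qed.
Fact oscaleDr : right_distributive oscale +%R.
Proof. by move=> k p q; rewrite /oscale scalerDr. Qed.
Fact oscaleDl p : {morph oscale^~ p : k l / k + l}.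
Proof. by move=> k l; rewrite /oscale !scalerDl. Qed.
HB.instance Definition _ := GRing.Zmodule_isLmodule.Build K S
  oscaleA oscale1 oscaleDr oscaleDl.
Fact oscaleAl (k : K) (p q : S) : k *: (p * q) = (k *: p) * q.
Proof. by rewrite [RHS]ore_mulZl. Qed.
HB.instance Definition _ := GRing.Lmodule_isLalgebra.Build K S oscaleAl.
Fact oscaleAr (k : K) (p q : S) : k *: (p * q) = p * (k *: q).
Proof. by rewrite [RHS]ore_mulZr. Qed.
HB.instance Definition _ := GRing.Lalgebra_isAlgebra.Build K S oscaleAr.

Definition oiota (r : R) : S := (r%:P : {poly R}).
Fact oiota_is_zmod_morphism : zmod_morphism oiota.
Proof. exact: raddfB. Qed.
HB.instance Definition _ :=
  GRing.isZmodMorphism.Build R S oiota oiota_is_zmod_morphism.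
Fact oiota_is_monoid_morphism : monoid_morphism oiota.
Proof.
split=> // a b; rewrite [RHS]ore_mulCl /oiota; apply/polyP => i.
by rewrite coefZ !coefC; case: eqP; rewrite ?mulr0.
Qed.
HB.instance Definition _ :=
  GRing.isMonoidMorphism.Build R S oiota oiota_is_monoid_morphism.
Fact oiota_is_scalable : scalable oiota.
Proof.
move=> k a; apply/polyP => i.
by rewrite [RHS]coefZ !coefC; case: eqP; rewrite ?mulr0 // mulr_algl.
Qed.
HB.instance Definition _ :=
  GRing.isScalable.Build K R S *:%R oiota oiota_is_scalable.

Definition ox : S := ('X : {poly R}).

Lemma oxM (q : S) : ox * q = x_times q.
Proof. by have := ore_mulMXl 1 q; rewrite mul1r ore_mul1l. Qed.

Lemma oxX i : ox ^+ i = 'X^i :> {poly R}.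
Proof.
by rewrite -iter_x_times1; elim: i => //= i IH; rewrite exprS oxM IH.
Qed.

Lemma ore_model : is_ore_extension oiota s d ox.
Proof.
have sumE (p : {poly R}) : \sum_(i < size p) oiota p`_i * ox ^+ i = p.
  rewrite -[RHS]coefK poly_def; apply: eq_bigr => i _.
  by rewrite oxX [LHS]ore_mulCl.
split=> [|p|r]; first exact: sd.
  by exists p; split=> [|q ->]; rewrite sumE.
by rewrite oxM /x_times !map_polyC /= [oiota (s r) * ox]ore_mulCl -mul_polyC.
Qed.

End OreModel.

Theorem ore_extension_exists (K : fieldType) (R : algType K)
    (s : {lrmorphism R -> R}) (d : {linear R -> R}) :
  is_sigma_derivation s d ->
  exists (S : algType K) (iota : {lrmorphism R -> S}) (x : S),
    is_ore_extension iota s d x.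
Proof.
move=> sd; exists (ore sd); exists (@oiota _ _ _ _ sd); exists (@ox _ _ _ _ sd).
exact: ore_model.
Qed.

(** * Universal property of an Ore extension *)

(** Lets a homomorphism be obtained from a function defined inside a proof. *)
Lemma pack_lrmorphism (K : fieldType) (A B : lalgType K) (g : A -> B) :
  linear g -> monoid_morphism g -> exists h : {lrmorphism A -> B}, h =1 g.
Proof.
move=> lin mon.
pose gL := GRing.isLinear.Build K A B *:%R g lin.
pose gM := GRing.isMonoidMorphism.Build A B g mon.
pose h : {lrmorphism A -> B} := HB.pack g gL gM.
by exists h.
Qed.

Definition subalgebra (K : fieldType) (A : lalgType K) (P : A -> Prop) : Prop :=
  [/\ P 1, forall (k : K) a b, P a -> P b -> P (k *: a + b)
    & forall a b, P a -> P b -> P (a * b)].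

Lemma subalgebra0 (K : fieldType) (A : lalgType K) (P : A -> Prop) :
  subalgebra P -> P 0.
Proof. by case=> P1 PD _; have := PD (-1) 1 1 P1 P1; rewrite scaleN1r addNr. Qed.

Section OreTheory.
Variables (K : fieldType) (R S : algType K) (iota : {lrmorphism R -> S}).
Variables (s : {lrmorphism R -> R}) (d : {linear R -> R}) (x : S).
Hypothesis H : is_ore_extension iota s d x.

Section Compatible.
Variables (T : algType K) (f : {lrmorphism R -> T}) (X : T).
Hypothesis fX : forall r, X * f r = f (s r) * X + f (d r).

Lemma skevalZr r p : skeval f X (r *: p) = f r * skeval f X p.
Proof.
rewrite (@skeval_widen _ _ _ _ _ (size p)) ?size_scale_leq // mulr_sumr.
by apply: eq_bigr => i _; rewrite coefZ rmorphM mulrA.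
Qed.

Lemma skeval_x_times p : skeval f X (x_times s d p) = X * skeval f X p.
Proof.
elim/poly_ind: p => [|p c IH]; first by rewrite raddf0 !skeval0 mulr0.
rewrite x_timesD x_timesMX !skevalD !skevalMX IH mulrDr mulrA skevalC fX;
  congr (_ + _).
by rewrite /x_times !map_polyC !skevalC.
Qed.

Lemma skeval_ore_mul p q :
  skeval f X (ore_mul s d p q) = skeval f X p * skeval f X q.
Proof.
elim/poly_ind: p q => [|p c IH] q.
  by rewrite /ore_mul size_poly0 big_ord0 !skeval0 mul0r.
rewrite ore_mulDl ore_mulMXl ore_mulCl !skevalD skevalMX IH skevalZr
  skeval_x_times.
by rewrite skevalC mulrDl mulrA.
Qed.

End Compatible.

Lemma ore_comm r : x * iota r = iota (s r) * x + iota (d r).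
Proof. by case: H. Qed.

Lemma skeval_bij a : exists! p, a = skeval iota x p.
Proof. by case: H => _ /(_ a). Qed.

Lemma skeval_inj : injective (skeval iota x).
Proof.
move=> p q e; have [r [_ u]] := skeval_bij (skeval iota x p).
by rewrite -(u p erefl) -(u q e).
Qed.

Fact skeval_surj a : exists p, a == skeval iota x p.
Proof. by have [p [/eqP]] := skeval_bij a; exists p. Qed.

(** The expansion in powers of x is chosen among the elements of a choiceType,
so no choice axiom enters. *)
Definition ore_coefs (a : S) : {poly R} := xchoose (skeval_surj a).

Lemma ore_coefsK a : skeval iota x (ore_coefs a) = a.
Proof. by rewrite -(eqP (xchooseP (skeval_surj a))). Qed.

Lemma skevalK p : ore_coefs (skeval iota x p) = p.
Proof. by apply: skeval_inj; rewrite ore_coefsK. Qed.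

(** Induction on the degree in x, peeling off the constant coefficient. *)
Lemma ore_ind (P : S -> Prop) :
  P 0 -> (forall a b, P a -> P (iota b + a * x)) -> forall a, P a.
Proof.
move=> P0 PS a; rewrite -(ore_coefsK a).
elim/poly_ind: (ore_coefs a) => [|p c IH]; first by rewrite skeval0.
by rewrite skevalD skevalMX skevalC addrC; apply: PS.
Qed.

Lemma ore_free a b : iota b + a * x = 0 -> b = 0 /\ a = 0.
Proof.
rewrite -{1}(ore_coefsK a) -(skevalC iota x) -skevalMX -skevalD.
rewrite -(skeval0 iota x); move/skeval_inj; rewrite addrC => /eqP;
  rewrite -cons_poly_def.
rewrite -size_poly_eq0 size_cons_poly; case: ifP => // /andP[e /eqP-> _].
move: e; rewrite nil_poly => /eqP e.
by split=> //; rewrite -(ore_coefsK a) e skeval0.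
Qed.

(** Evaluation at X of the x-expansion is multiplicative as soon as X satisfies
the commutation rule of x, by the same computation that makes the product of the
model associative. *)
Lemma ore_universal (T : algType K) (f : {lrmorphism R -> T}) (X : T) :
  (forall r, X * f r = f (s r) * X + f (d r)) ->
  exists2 g : {lrmorphism S -> T}, forall r, g (iota r) = f r & g x = X.
Proof.
move=> fX; pose g a := skeval f X (ore_coefs a).
have gE p : g (skeval iota x p) = skeval f X p by rewrite /g skevalK.
have glin : linear g.
  move=> k a b; rewrite -(ore_coefsK a) -(ore_coefsK b).
  by rewrite -skevalZ -skevalD !gE skevalD skevalZ.
have g1 r : g (iota r) = f r by rewrite -(skevalC iota x) gE skevalC.
have gmon : monoid_morphism g.
  split=> [|a b]; first by rewrite -(rmorph1 iota) g1 rmorph1.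
  rewrite -(ore_coefsK a) -(ore_coefsK b) -(skeval_ore_mul ore_comm) !gE.
  exact: skeval_ore_mul.
have [h hE] := pack_lrmorphism glin gmon; exists h => [r|]; rewrite hE //.
have xE : x = skeval iota x 'X.
  by rewrite -['X]mul1r skevalMX -[1]/(1%:P) skevalC rmorph1 mul1r.
by rewrite [in LHS]xE gE -['X]mul1r skevalMX -[1]/(1%:P) skevalC rmorph1 mul1r.
Qed.

Lemma subalgebra_ore (P : S -> Prop) :
  subalgebra P -> (forall r, P (iota r)) -> P x -> forall a, P a.
Proof.
move=> sP Pi Px; apply: ore_ind => [|a b Pa]; first exact: subalgebra0 sP.
case: sP => _ PD PM; rewrite -[iota b]scale1r; apply: PD => //; exact: PM.
Qed.

End OreTheory.

(** The commutation rule with X needs to be verified on generators only. *)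
Lemma subalgebra_compatible (K : fieldType) (R T : algType K)
    (s : {lrmorphism R -> R}) (d : {linear R -> R})
    (f : {lrmorphism R -> T}) (X : T) :
  is_sigma_derivation s d ->
  subalgebra (fun r => X * f r = f (s r) * X + f (d r)).
Proof.
move=> sd; split=> [|k a b ea eb|a b ea eb].
- by rewrite (derivation1 sd) linear0 !rmorph1 mulr1 mul1r addr0.
- rewrite !linearP /= mulrDr -scalerAr ea eb mulrDl -scalerAl scalerDr.
  by rewrite addrACA.
- rewrite sd !rmorphM linearD !rmorphM mulrA ea mulrDl -mulrA eb mulrDr.
  by rewrite !mulrA addrA.
Qed.

Section Triangular.
Variables (K : fieldType) (A : algType K).

(** The triple (a, b, c) stands for the upper triangular matrix with rows (a, b)
and (0, c). *)
Definition tri := (A * A * A)%type.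
HB.instance Definition _ := GRing.Lmodule.copy tri (A * A * A)%type.

Definition tri_one : tri := (1, 0, 1).
Definition tri_mul (p q : tri) : tri :=
  (p.1.1 * q.1.1, p.1.1 * q.1.2 + p.1.2 * q.2, p.2 * q.2).

Lemma triP (p q : tri) : p.1.1 = q.1.1 -> p.1.2 = q.1.2 -> p.2 = q.2 -> p = q.
Proof. by case: p q => [[? ?] ?] [[? ?] ?] /= -> -> ->. Qed.

Fact tri_mulA : associative tri_mul.
Proof.
by move=> p q r; apply: triP; rewrite /= ?mulrDr ?mulrDl ?mulrA ?addrA.
Qed.
Fact tri_mul1l : left_id tri_one tri_mul.
Proof. by move=> p; apply: triP; rewrite /= ?mul1r ?mul0r ?addr0. Qed.
Fact tri_mul1r : right_id tri_one tri_mul.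
Proof. by move=> p; apply: triP; rewrite /= ?mulr1 ?mulr0 ?add0r. Qed.
Fact tri_mulDl : left_distributive tri_mul +%R.
Proof. by move=> p q r; apply: triP; rewrite /= ?mulrDl // addrACA. Qed.
Fact tri_mulDr : right_distributive tri_mul +%R.
Proof. by move=> p q r; apply: triP; rewrite /= ?mulrDr // addrACA. Qed.
Fact tri_one_neq0 : tri_one != 0 :> tri.
Proof. by apply/eqP => /(congr1 snd) /eqP; rewrite oner_eq0. Qed.
HB.instance Definition _ := GRing.Zmodule_isNzRing.Build tri
  tri_mulA tri_mul1l tri_mul1r tri_mulDl tri_mulDr tri_one_neq0.
Lemma tri_mulE (p q : tri) :
  p * q = (p.1.1 * q.1.1, p.1.1 * q.1.2 + p.1.2 * q.2, p.2 * q.2).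
Proof. by []. Qed.

Lemma tri_scaleE (k : K) (p : tri) :
  k *: p = (k *: p.1.1, k *: p.1.2, k *: p.2).
Proof. by case: p => [[]]. Qed.

Fact tri_scaleAl (k : K) (p q : tri) : k *: (p * q) = (k *: p : tri) * q.
Proof. by rewrite !tri_mulE !tri_scaleE /= scalerDr !scalerAl. Qed.
HB.instance Definition _ := GRing.Lmodule_isLalgebra.Build K tri tri_scaleAl.
Fact tri_scaleAr (k : K) (p q : tri) : k *: (p * q) = p * (k *: q : tri).
Proof. by rewrite !tri_mulE !tri_scaleE /= scalerDr !scalerAr. Qed.
HB.instance Definition _ := GRing.Lalgebra_isAlgebra.Build K tri tri_scaleAr.

(** The off-diagonal entry of a product of triangular matrices is the Leibniz
rule of a sigma-derivation. *)
Lemma sigma_derivation_of_tri (phi : {lrmorphism A -> tri}) :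
  (forall a, (phi a).2 = a) ->
  exists (s : {lrmorphism A -> A}) (d : {linear A -> A}),
    is_sigma_derivation s d /\ forall a, phi a = (s a, d a, a).
Proof.
move=> phi2.
have slin : linear (fun a => (phi a).1.1) by move=> k a b; rewrite linearP.
have smon : monoid_morphism (fun a => (phi a).1.1).
  by split=> [|a b]; rewrite ?rmorph1 ?rmorphM.
have dlin : linear (fun a => (phi a).1.2) by move=> k a b; rewrite linearP.
have [s sE] := pack_lrmorphism slin smon.
pose d : {linear A -> A} := HB.pack (fun a => (phi a).1.2)
  (GRing.isLinear.Build K A A *:%R (fun a => (phi a).1.2) dlin).
exists s, d; split=> [a b|a]; last by apply: triP; rewrite /= ?sE.
by rewrite sE /= rmorphM /= phi2.
Qed.

End Triangular.

(** * Gradings and Hilbert series of Ore extensions *)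

Section Homogeneous.
Variables (K : fieldType) (A : algType K) (n : nat) (gens : n.-tuple (A * nat)).

Lemma eq_monomial e e' : e =1 e' -> monomial gens e = monomial gens e'.
Proof. by move=> ee; apply: eq_bigr => i _; rewrite ee. Qed.

Lemma eq_monomial_degree e e' :
  e =1 e' -> monomial_degree gens e = monomial_degree gens e'.
Proof. by move=> ee; apply: eq_bigr => i _; rewrite ee. Qed.

Lemma homogeneous_lin m (k : K) a b :
  homogeneous gens m a -> homogeneous gens m b -> homogeneous gens m (k *: a + b).
Proof.
move=> [c ->] [c' ->]; exists (fun e => k * c e + c' e).
rewrite scaler_sumr -big_split; apply: eq_bigr => e _.
by rewrite scalerDl scalerA.
Qed.

Lemma homogeneous0 m : homogeneous gens m 0.
Proof. by exists (fun=> 0); rewrite big1 // => e _; rewrite scale0r. Qed.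

Lemma homogeneousZ m (k : K) a :
  homogeneous gens m a -> homogeneous gens m (k *: a).
Proof.
by move=> ha; rewrite -[_ *: _]addr0; apply: homogeneous_lin (homogeneous0 m).
Qed.

(** Homogeneous elements of degree m are the span of the monomials of degree m. *)
Lemma homogeneous_ind m (P : A -> Prop) :
    P 0 -> (forall (k : K) a b, P a -> P b -> P (k *: a + b)) ->
    (forall e, monomial_degree gens e = m -> P (monomial gens e)) ->
  forall a, homogeneous gens m a -> P a.
Proof.
move=> P0 PD Pm _ [c ->]; elim/big_rec: _ => // e a /eqP em Pa.
by apply: PD => //; apply: Pm.
Qed.

Hypothesis deg_gt0 : forall i, (0 < (tnth gens i).2)%N.

(** As all degrees are positive, no exponent exceeds the total degree, so the
bounded exponents in the definition of homogeneous elements suffice. *)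
Lemma homogeneous_monomial e :
  homogeneous gens (monomial_degree gens e) (monomial gens e).
Proof.
set m := monomial_degree gens e.
have le_em i : (e i <= m)%N.
  rewrite /m /monomial_degree (bigD1 i) //=.
  by apply: leq_trans (leq_addr _ _); rewrite leq_pmulr.
pose f : {ffun 'I_n -> 'I_m.+1} := [ffun i => inord (e i)].
have fE : (fun i => f i : nat) =1 e by move=> i; rewrite ffunE inordK // ltnS.
exists (fun g => (g == f)%:R); rewrite (bigD1 f) /=; last first.
  by rewrite (eq_monomial_degree fE).
rewrite eqxx scale1r (eq_monomial fE) big1 ?addr0 // => g /andP[_ /negPf->].
by rewrite scale0r.
Qed.

Lemma homogeneous_genX i k :
  homogeneous gens (k * (tnth gens i).2) ((tnth gens i).1 ^+ k).
Proof.
pose e j := if j == i then k else 0%N.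
have -> : (tnth gens i).1 ^+ k = monomial gens e.
  rewrite -[LHS](big_pred1_eq *%R i (fun j => (tnth gens j).1 ^+ k)) big_mkcond.
  by apply: eq_bigr => j _; rewrite /e; case: eqP.
have -> : (k * (tnth gens i).2)%N = monomial_degree gens e.
  rewrite /monomial_degree (bigD1 i) //= /e eqxx big1 ?addn0 // => j /negPf->.
  by rewrite mul0n.
exact: homogeneous_monomial.
Qed.

End Homogeneous.

Section Dimension.
Variables (K : fieldType).

Lemma has_dim_eq (E : lmodType K) (V W : E -> Prop) d :
  (forall u, V u <-> W u) -> has_dim V d -> has_dim W d.
Proof. by move=> VW [v [vf vs]]; exists v; split=> // u; rewrite -VW. Qed.

Lemma has_dim_zero (E : lmodType K) : has_dim (fun u : E => u = 0) 0.
Proof.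
exists (fun=> 0); split=> [c _ []//|u].
by split=> [->|[c ->]]; [exists (fun=> 0)|]; rewrite big_ord0.
Qed.

Lemma has_dim_sum (E F G : lmodType K) (V : E -> Prop) (W : F -> Prop) p q
    (f : {linear E -> G}) (g : {linear F -> G}) :
  (forall a b, f a + g b = 0 -> a = 0 /\ b = 0) ->
  has_dim V p -> has_dim W q ->
  has_dim (fun u => exists a b, [/\ V a, W b & u = f a + g b]) (p + q).
Proof.
move=> fg0 [v [vf vs]] [w [wf ws]].
pose z i := match split i with inl j => f (v j) | inr j => g (w j) end.
have zE (c : 'I_(p + q) -> K) : \sum_i c i *: z i =
    f (\sum_i c (lshift q i) *: v i) + g (\sum_i c (rshift p i) *: w i).
  rewrite big_split_ord !raddf_sum; congr (_ + _); apply: eq_bigr => i _.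
    by rewrite /z (unsplitK (inl i)) /= linearZ.
  by rewrite /z (unsplitK (inr i)) /= linearZ.
exists z; split=> [c|u].
  rewrite zE => /fg0[/vf c1 /wf c2] i.
  by case: (split_ordP i) => j ->.
split=> [[a [b [/vs[c ->] /ws[c' ->] ->]]]|[c ->]].
  exists (fun i => match split i with inl j => c j | inr j => c' j end).
  rewrite zE; congr (f _ + g _); apply: eq_bigr => i _.
    by rewrite (unsplitK (inl i)).
  by rewrite (unsplitK (inr i)).
rewrite zE; do 2!eexists; split; last by [].
  by apply/vs; exists (fun i => c (lshift q i)).
by apply/ws; exists (fun i => c (rshift p i)).
Qed.

End Dimension.

(** Coefficients of h(t) / (1 - t^d); the fuel makes the recursion from m to
m - d structural, and m + 1 units are enough when d > 0. *)
Fixpoint over_geom_aux (d : nat) (h : nat -> nat) (fuel m : nat) : nat :=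
  if fuel is f.+1 then
    (h m + if (d <= m)%N then over_geom_aux d h f (m - d) else 0)%N
  else 0%N.

Definition over_geom d h m := over_geom_aux d h m.+1 m.

Lemma over_geomE d h m : (0 < d)%N ->
  over_geom d h m = (h m + if (d <= m)%N then over_geom d h (m - d) else 0)%N.
Proof.
move=> d0.
have auxE f f' k : (k < f)%N -> (k < f')%N -> over_geom_aux d h f k =
  over_geom_aux d h f' k.
  elim: f f' k => [|f IH] [|f'] k //= kf kf'; case: ifP => // dk.
  by congr (_ + _)%N; apply: IH; lia.
rewrite {1}/over_geom /=; case: ifP => // dm; congr (_ + _)%N; apply: auxE; lia.
Qed.

Definition series_inv (q : {poly int}) (h : nat -> nat) : Prop :=
  forall m, \sum_(i < m.+1) q`_i * (h (m - i)%N)%:Z = (m == 0%N)%:R.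

(** Cauchy products are read off as coefficients of polynomials truncated above
degree m, where multiplication by 1 - t^d undoes over_geom. *)
Lemma series_inv_over_geom d q h : (0 < d)%N ->
  series_inv q h -> series_inv (q * (1 - 'X^d)) (over_geom d h).
Proof.
move=> d0 qh m; rewrite -qh.
pose P f := \poly_(i < m.+1) (f i : nat)%:Z.
have trunc (r : {poly int}) f :
    \sum_(i < m.+1) r`_i * (f (m - i)%N)%:Z = (r * P f)`_m.
  rewrite coefM; apply: eq_bigr => i _; rewrite coef_poly.
  by rewrite ltnS leq_subr.
rewrite !trunc -mulrA !coefM; apply: eq_bigr => i _; congr (_ * _).
rewrite mulrBl mul1r coefB coefXnM !coef_poly !ltnS !leq_subr (over_geomE h _ d0).
case: ltnP => dm; first by rewrite addn0 subr0.
by rewrite (leq_trans (leq_subr _ _)) ?leq_subr // PoszD addrK.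
Qed.

Section OreGraded.
Variables (K : fieldType) (R S : algType K) (iota : {lrmorphism R -> S}).
Variables (s : {lrmorphism R -> R}) (d : {linear R -> R}) (x : S).
Hypothesis H : is_ore_extension iota s d x.
Variables (n : nat) (gens : n.-tuple (R * nat)) (dx : nat).
Hypothesis deg_gt0 : forall i, (0 < (tnth gens i).2)%N.
Hypothesis dx_gt0 : (0 < dx)%N.

Definition ore_gens : n.+1.-tuple (S * nat) :=
  [tuple of rcons [tuple of [seq (iota g.1, g.2) | g <- gens]] (x, dx)].

Lemma tnth_ore_gens_lift i : tnth ore_gens (lift ord_max i) =
  (iota (tnth gens i).1, (tnth gens i).2).
Proof.
rewrite (tnth_nth (x, dx)) lift_max /= nth_rcons size_map size_tuple ltn_ord.
by rewrite (nth_map (tnth gens i)) ?size_tuple // -tnth_nth.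
Qed.

Lemma tnth_ore_gens_max : tnth ore_gens ord_max = (x, dx).
Proof.
by rewrite (tnth_nth (x, dx)) /= nth_rcons size_map size_tuple ltnn eqxx.
Qed.

Lemma ord_max_lift (i : 'I_n) : widen_ord (leqnSn n) i = lift ord_max i.
Proof. by apply: val_inj; rewrite [RHS]lift_max. Qed.

Definition exps_rcons (e : 'I_n -> nat) (k : nat) : 'I_n.+1 -> nat :=
  fun i => oapp e k (unlift ord_max i).

Lemma ore_gens_deg_gt0 i : (0 < (tnth ore_gens i).2)%N.
Proof.
case: (unliftP ord_max i) => [j|] ->; last by rewrite tnth_ore_gens_max.
by rewrite tnth_ore_gens_lift; apply: deg_gt0.
Qed.

Lemma monomial_ore e : monomial ore_gens e =
  iota (monomial gens (fun i => e (lift ord_max i))) * x ^+ e ord_max.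
Proof.
rewrite /monomial big_ord_recr /= tnth_ore_gens_max rmorph_prod; congr (_ * _).
by apply: eq_bigr => i _; rewrite ord_max_lift tnth_ore_gens_lift rmorphXn.
Qed.

Lemma monomial_degree_ore e : monomial_degree ore_gens e =
  (monomial_degree gens (fun i => e (lift ord_max i)) + e ord_max * dx)%N.
Proof.
rewrite /monomial_degree big_ord_recr /= tnth_ore_gens_max; congr (_ + _)%N.
by apply: eq_bigr => i _; rewrite ord_max_lift tnth_ore_gens_lift.
Qed.

Lemma monomial_rcons e k :
  monomial ore_gens (exps_rcons e k) = iota (monomial gens e) * x ^+ k.
Proof.
rewrite monomial_ore {2}/exps_rcons unlift_none; congr (iota _ * _).
by apply: eq_monomial => i; rewrite /exps_rcons liftK.
Qed.

Lemma monomial_degree_rcons e k :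
  monomial_degree ore_gens (exps_rcons e k) =
    (monomial_degree gens e + k * dx)%N.
Proof.
rewrite monomial_degree_ore {2}/exps_rcons unlift_none; congr (_ + _)%N.
by apply: eq_monomial_degree => i; rewrite /exps_rcons liftK.
Qed.

Lemma homogeneous_iota m b :
  homogeneous gens m b -> homogeneous ore_gens m (iota b).
Proof.
move: b; apply: homogeneous_ind => [|k a b ha hb|e em].
- by rewrite linear0; apply: homogeneous0.
- by rewrite linearP; apply: homogeneous_lin.
rewrite -em -[iota _]mulr1 -[1]/(x ^+ 0) -monomial_rcons.
have -> : monomial_degree gens e = monomial_degree ore_gens (exps_rcons e 0).
  by rewrite monomial_degree_rcons addn0.
exact: homogeneous_monomial ore_gens_deg_gt0 _.
Qed.

Lemma homogeneous_Mx m c :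
  homogeneous ore_gens m c -> homogeneous ore_gens (m + dx) (c * x).
Proof.
move: c; apply: homogeneous_ind => [|k a b ha hb|e em].
- by rewrite mul0r; apply: homogeneous0.
- by rewrite mulrDl -scalerAl; apply: homogeneous_lin.
rewrite monomial_ore -mulrA -exprSr -monomial_rcons.
rewrite -em monomial_degree_ore -addnA -mulSnr -monomial_degree_rcons.
exact: homogeneous_monomial ore_gens_deg_gt0 _.
Qed.

(** A monomial either is free of x or ends in x. This splitting, unique by
ore_free, gives the recursion h'(m) = h(m) + h'(m - deg x) on dimensions. *)
Lemma homogeneous_oreP m a : homogeneous ore_gens m a <->
  exists b c, [/\ homogeneous gens m b,
    (if (dx <= m)%N then homogeneous ore_gens (m - dx) c else c = 0)
    & a = iota b + c * x].
Proof.
split=> [|[b [c [hb hc ->]]]]; last first.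
  rewrite -[iota b]scale1r; apply: homogeneous_lin.
    exact: homogeneous_iota.
  case: leqP hc => [le_dm hc|_ ->]; last by rewrite mul0r; apply: homogeneous0.
  by rewrite -(subnK le_dm); apply: homogeneous_Mx.
move: a; apply: homogeneous_ind => [|k a a'|e em].
- exists 0, 0; split; first exact: homogeneous0.
    by case: ifP => // _; apply: homogeneous0.
  by rewrite linear0 mul0r addr0.
- move=> [b [c [hb hc ->]]] [b' [c' [hb' hc' ->]]].
  exists (k *: b + b'), (k *: c + c'); split; first exact: homogeneous_lin.
    case: ifP hc hc' => [_|_ -> ->]; last by rewrite scaler0 addr0.
    exact: homogeneous_lin.
  by rewrite linearP mulrDl -scalerAl scalerDr addrACA.
move: em; rewrite monomial_degree_ore monomial_ore.
set e' := fun i => _; case: (e ord_max) => [|k] em.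
  exists (monomial gens e'), 0; split; last by rewrite mulr1 mul0r addr0.
    by rewrite -em addn0; apply: homogeneous_monomial.
  by case: ifP => // _; apply: homogeneous0.
exists 0, (monomial ore_gens (exps_rcons e' k)); split.
- exact: homogeneous0.
- have [-> ->] : (dx <= m)%N /\ (m - dx)%N = monomial_degree ore_gens
  (exps_rcons e' k).
    by rewrite monomial_degree_rcons; split; lia.
  exact: homogeneous_monomial ore_gens_deg_gt0 _.
by rewrite linear0 add0r monomial_rcons -mulrA -exprSr.
Qed.

Lemma has_dim_ore h :
  (forall m, has_dim (homogeneous gens m) (h m)) ->
  forall m, has_dim (homogeneous ore_gens m) (over_geom dx h m).
Proof.
move=> hdim; elim/ltn_ind => m IH; rewrite over_geomE //.
pose g (c : S) := c * x.
have glin : linear g by move=> k a b; rewrite /g mulrDl scalerAl.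
pose gL : {linear S -> S} := HB.pack g (GRing.isLinear.Build K S S *:%R g glin).
pose W c := if (dx <= m)%N then homogeneous ore_gens (m - dx) c else c = 0.
have Wdim : has_dim W (if (dx <= m)%N then over_geom dx h (m - dx) else 0%N).
  rewrite /W; case: leqP => [ledm|_]; last exact: has_dim_zero.
  by apply: IH; rewrite ltn_subrL dx_gt0 (leq_trans dx_gt0).
have free a b : iota a + gL b = 0 -> a = 0 /\ b = 0 by move/(ore_free H).
apply: has_dim_eq (has_dim_sum free (hdim m) Wdim) => u.
by rewrite homogeneous_oreP.
Qed.

End OreGraded.

(** * Towers of graded Ore extensions *)

(** Invariant carried along the construction; q is the inverse of the Hilbert
series. *)
Record ore_tower (K : fieldType) (A : algType K) (n : nat)
    (gens : n.-tuple (A * nat)) (q : {poly int}) : Prop := OreTower {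
  tower_ore : exists T : graded_iterated_ore gens, sigmas_injective T;
  tower_deg : forall i, (0 < (tnth gens i).2)%N;
  tower_gen : forall P : A -> Prop, subalgebra P ->
    (forall i, P (tnth gens i).1) -> forall a, P a;
  tower_hilb : exists2 h,
    forall m, has_dim (homogeneous gens m) (h m) & series_inv q h }.

(** Computes to a conjunction on an explicit list. *)
Fixpoint all_prop (T : Type) (P : T -> Prop) (s : seq T) : Prop :=
  if s is a :: s' then P a /\ all_prop P s' else True.

Lemma all_prop_tnth (T : Type) n (t : n.-tuple T) (P : T -> Prop) :
  all_prop P t -> forall i, P (tnth t i).
Proof.
case: n t => [|n] t Pt i; first by case: i.
rewrite (tnth_nth (tnth t i)).
have := ltn_ord i; rewrite -[X in (_ < X)%N](size_tuple t).
move: (tnth t i) (i : nat) => a; elim: (tval t) Pt => [|b s IH] //= [Pb Ps].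
by case=> // k; apply: IH.
Qed.

(** One Ore step, from a homomorphism phi into triangular matrices given on the
generators. As sigma multiplies each generator by an N-th root of unity, its N-th
iterate fixes all generators and hence is the identity, so sigma is injective. *)
Lemma ore_tower_step (K : fieldType) (R : algType K) (n : nat)
    (gens : n.-tuple (R * nat)) (q : {poly int}) (dx N : nat)
    (phi : {lrmorphism R -> tri R}) :
  ore_tower gens q -> (0 < dx)%N -> (0 < N)%N ->
  all_prop (fun g => exists2 c : K, c ^+ N = 1 &
     exists2 e, homogeneous gens (dx + g.2) e & phi g.1 = (c *: g.1, e, g.1))
    gens ->
  exists (A : algType K) (iota : {lrmorphism R -> A}) (x : A),
    [/\ ore_tower (ore_gens iota x gens dx) (q * (1 - 'X^dx)),
        forall r, x * iota r = iota (phi r).1.1 * x + iota (phi r).1.2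
      & forall (T : algType K) (f : {lrmorphism R -> T}) (X : T),
          all_prop (fun g =>
            X * f g.1 = f (phi g.1).1.1 * X + f (phi g.1).1.2) gens ->
        exists2 g : {lrmorphism A -> T}, forall r, g (iota r) = f r & g x = X].
Proof.
move=> tow dx0 N0 /all_prop_tnth phiE;
  case: (tow) => -[T Tinj] deg gen [h hdim hq].
have [s [d [sd sdE]]] : exists (s : {lrmorphism R -> R}) (d : {linear R -> R}),
    is_sigma_derivation s d /\ forall a, phi a = (s a, d a, a).
  apply: sigma_derivation_of_tri; apply: gen => [|i]; last first.
    by have [c _ [e _ ->]] := phiE i.
  split=> [|k a b ea eb|a b ea eb]; first by rewrite rmorph1.
    by rewrite linearP /= ea eb.
  by rewrite rmorphM /= ea eb.
have sE i : exists2 c : K, c ^+ N = 1 & s (tnth gens i).1 = c *: (tnth gens i).1.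
  by have [c cN [e _]] := phiE i; rewrite sdE => -[-> _]; exists c.
have dE i : homogeneous gens (dx + (tnth gens i).2) (d (tnth gens i).1).
  by have [c cN [e he]] := phiE i; rewrite sdE => -[_ ->].
have sN a : iter N s a = a.
  move: a; apply: gen => [|i].
    split=> [|k a b|a b].
    - by elim: N {N0 phiE sE} => //= N' ->; rewrite rmorph1.
    - have -> : iter N s (k *: a + b) = k *: iter N s a + iter N s b.
        by elim: N {N0 phiE sE} => //= N' ->; rewrite linearP.
      by move=> -> ->.
    - have -> : iter N s (a * b) = iter N s a * iter N s b.
        by elim: N {N0 phiE sE} => //= N' ->; rewrite rmorphM.
      by move=> -> ->.
  have [c cN si] := sE i.
  have : iter N s (tnth gens i).1 = c ^+ N *: (tnth gens i).1.
    elim: N {N0 cN phiE sE} => [|N' IH] /=; first by rewrite scale1r.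
    by rewrite IH linearZ /= si scalerA -exprSr.
  by rewrite cN scale1r.
have sinj : injective s.
  move=> a b sab; rewrite -(sN a) -(sN b).
  by case: N N0 {sN phiE sE} => // N' _; rewrite !iterSr sab.
have [A [iota [x HA]]] := ore_extension_exists sd.
exists A, iota, x; split.
- split.
  + unshelve eexists.
      apply: (@Ore_step K R A n gens iota s d x dx T HA dx0 _ dE) => i.
      have [c _ ->] := sE i; apply: homogeneousZ.
      by have := homogeneous_genX deg i 1; rewrite mul1n expr1.
    by [].
  + exact: ore_gens_deg_gt0.
  + move=> P sP Pg; apply: (subalgebra_ore HA) => //.
      apply: gen => [|i].
        case: sP => P1 PD PM; split=> [|k a b|a b]; rewrite ?rmorph1 //.
          by rewrite linearP; apply: PD.
        by rewrite rmorphM; apply: PM.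
      by have := Pg (lift ord_max i); rewrite tnth_ore_gens_lift.
    by have := Pg ord_max; rewrite tnth_ore_gens_max.
  + exists (over_geom dx h); first exact: (has_dim_ore HA deg dx0 hdim).
    exact: series_inv_over_geom.
- by move=> r; rewrite sdE; exact: (ore_comm HA).
move=> T' f X /all_prop_tnth fX; apply: (ore_universal HA); apply: gen => [|i].
  exact: subalgebra_compatible.
by rewrite fX sdE.
Qed.

Lemma ore_tower_base (K : fieldType) :
  @ore_tower K K^o 0 [tuple] 1.
Proof.
split.
- by exists (Ore_base K).
- by case.
- move=> P [P1 PD _] _ a; have := PD (a - 1) 1 1 P1 P1.
  by rewrite [_ *: _]mulr1 subrK.
exists (fun m => (m == 0)%N : nat) => [[|m]|m].
- exists (fun=> 1); split=> [c|u].
    by rewrite big_ord1 [_ *: _]mulr1 => c0 i; rewrite ord1.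
  have deg0 (e : 'I_0 -> nat) : monomial_degree ([tuple] : 0.-tuple (K^o *
    nat)) e = 0%N.
    by rewrite /monomial_degree big_ord0.
  split=> _; first by exists (fun=> u); rewrite big_ord1 [_ *: _]mulr1.
  have e0 : {ffun 'I_0 -> 'I_1} by exact: [ffun=> ord0].
  exists (fun=> u); rewrite (bigD1 e0) ?deg0 //= big1 => [|e /andP[_ /eqP[]]].
    by rewrite addr0 /monomial big_ord0 [_ *: _]mulr1.
  by apply/ffunP; case.
- apply: has_dim_eq (has_dim_zero _) => u; split=> [->|[c ->]].
    exact: homogeneous0.
  by rewrite big1 // => e /eqP; rewrite /monomial_degree big_ord0.
rewrite big_ord_recl big1 => [|i _]; last by rewrite coef1 /= mul0r.
by rewrite coef1 mul1r subn0 addr0; case: m.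
Qed.

(** * Linear arithmetic and the defining relations *)

Section LinearExpr.
Variables (K : fieldType) (V : lmodType K).

(** Reified linear combinations, used to reduce an equality of linear
combinations of vectors to the equalities of the coefficients of each vector. *)
Inductive lexp : Type :=
| LZero | LAtom of nat | LAdd of lexp & lexp | LOpp of lexp
| LScale of K & lexp.

Fixpoint leval (env : seq V) (e : lexp) : V :=
  match e with
  | LZero => 0
  | LAtom i => env`_i
  | LAdd e1 e2 => leval env e1 + leval env e2
  | LOpp e1 => - leval env e1
  | LScale k e1 => k *: leval env e1
  end.

Fixpoint lcoef (e : lexp) (i : nat) : K :=
  match e with
  | LZero => 0
  | LAtom j => if Nat.eqb i j then 1 else 0
  | LAdd e1 e2 => lcoef e1 i + lcoef e2 i
  | LOpp e1 => - lcoef e1 i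
  | LScale k e1 => k * lcoef e1 i
  end.

Lemma levalE env e : leval env e = \sum_(i < size env) lcoef e i *: env`_i.
Proof.
elim: e => [|j|e1 IH1 e2 IH2|e IH|k e IH] /=.
- by rewrite big1 // => i _; rewrite scale0r.
- have E (i : nat) : (if Nat.eqb i j then 1 else 0 : K) = (i == j)%:R.
    by rewrite -[Nat.eqb i j]/(i == j)%N; case: eqP.
  have [ltj|lej] := ltnP j (size env).
    rewrite (bigD1 (Ordinal ltj)) //= E eqxx scale1r big1 ?addr0 // => i.
    by rewrite -val_eqE /= E => /negPf ->; rewrite scale0r.
  rewrite nth_default // big1 // => i _; rewrite E.
  by case: eqP => [ij|_]; rewrite ?scale0r //; move: (ltn_ord i);
    rewrite ij ltnNge lej.
- by rewrite IH1 IH2 -big_split; apply: eq_bigr => i _; rewrite scalerDl.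
- by rewrite IH -sumrN; apply: eq_bigr => i _; rewrite scaleNr.
by rewrite IH scaler_sumr; apply: eq_bigr => i _; rewrite scalerA.
Qed.

Fixpoint lcoef_eq (e1 e2 : lexp) (n : nat) : Prop :=
  if n is m.+1 then lcoef e1 m = lcoef e2 m /\ lcoef_eq e1 e2 m else True.

Lemma leval_eq env e1 e2 :
  lcoef_eq e1 e2 (size env) -> leval env e1 = leval env e2.
Proof.
move=> E; rewrite !levalE; apply: eq_bigr => i _; congr (_ *: _).
elim: (size env) i E => [[] //|n IH] i /= [En E].
have [lti|] := ltnP i n; first exact: (IH (Ordinal lti)).
by move=> leni; have -> : (i : nat) = n by have := ltn_ord i; lia.
Qed.

End LinearExpr.

(** Atoms are compared up to conversion, since equal monomials may carry different
canonical structures of the same algebra. *)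
Ltac lin_index a env :=
  match env with
  | ?b :: _ => let _ := constr:(erefl a : a = b) in constr:(0%N)
  | _ :: ?t => let i := lin_index a t in constr:(S i)
  end.
Ltac lin_mem a env :=
  match env with
  | nil => constr:(false)
  | ?b :: _ => let _ := constr:(erefl a : a = b) in constr:(true)
  | _ :: ?t => lin_mem a t
  end.
Ltac lin_atoms env t :=
  lazymatch t with
  | ?a + ?b => let env' := lin_atoms env a in lin_atoms env' b
  | - ?a => lin_atoms env a
  | ?k *: ?a => lin_atoms env a
  | 0 => env
  | _ => match lin_mem t env with
         | true => env
         | false => constr:(t :: env)
         end
  end.
Ltac lin_reify K env t :=
  lazymatch t with
  | ?a + ?b => let x := lin_reify K env a in let y := lin_reify K env b in
               constr:(LAdd x y)
  | - ?a => let x := lin_reify K env a in constr:(LOpp x)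
  | ?k *: ?a => let x := lin_reify K env a in constr:(LScale k x)
  | 0 => constr:(LZero K)
  | _ => let i := lin_index t env in constr:(LAtom K i)
  end.
Ltac lin_decompose K V :=
  lazymatch goal with
  | |- ?l = ?r =>
    let env := lin_atoms (@nil V) l in
    let env := lin_atoms env r in
    let x := lin_reify K env l in
    let y := lin_reify K env r in
    apply: (@leval_eq K V env x y); rewrite /=; repeat split
  end.

Section Relations.
Variables (K : fieldType) (u : K).

Section Def.
Variable T : algType K.
Implicit Types y w v z x : T.
Definition rel_w y w := w * y = u ^+ 2 *: (y * w).
Definition rel_v y w v :=
  v * y = u ^+ 2 *: (y * v) - w * w /\ v * w = u ^+ 2 *: (w * v).
Definition rel_z y w v z :=
  [/\ z * y = y * z + w, z * w = u *: (w * z) + v & z * v = u ^+ 2 *: (v * z)].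
Definition rel_x y w v z x :=
  [/\ x * y = - u *: (y * x) + z,
      x * w = - u ^+ 2 *: (w * x) + u ^+ 2 *: (z * z),
      x * v = v * x & x * z = u *: (z * x)].
End Def.

Hypothesis hu : u ^+ 2 = u - 1.

(** The form of a rewrite rule a b = c inside a product associated to the left. *)
Lemma mulA_rule (T : algType K) (a b c : T) : a * b = c ->
  forall t, t * a * b = t * c.
Proof. by move=> <- t; rewrite mulrA. Qed.

Definition expand (T : algType K) :=
  (@mulrDl T, @mulrDr T, @mulNr T, @mulrN T, @mul0r T, @mulr0 T,
   =^~ @scalerAl K T, =^~ @scalerAr K T, @scaler0 K T,
   @scalerDr K T, @scalerN K T, @scalerA K T, @mulrA T).

Section ThreeRelations.
Variables (T : algType K) (y w v z x : T).
Hypotheses (xy : x * y = - u *: (y * x) + z) (zy : z * y = y * z + w)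
  (zw : z * w = u *: (w * z) + v).
Hypotheses (xz : x * z = u *: (z * x)) (wy : rel_w y w)
  (zv : z * v = u ^+ 2 *: (v * z)).

(** The defining relations of w, v, z and three others imply all of them. Each new
relation comes from computing one word in two ways. *)
Lemma three_relations : rel_v y w v /\ rel_x y w v z x.
Proof.
have xy' := mulA_rule xy; have zy' := mulA_rule zy; have zw' := mulA_rule zw.
have xz' := mulA_rule xz; have wy' := mulA_rule wy; have zv' := mulA_rule zv.
have wE : w = z * y - y * z by rewrite zy addrC addKr.
have vE : v = z * w - u *: (w * z) by rewrite zw addrC addKr.
have xw : x * w = - u ^+ 2 *: (w * x) + u ^+ 2 *: (z * z).
  by rewrite {1}wE !(expand, xz, xz', xy, xy') !(expand, zy, zy');
     lin_decompose K T; ring: hu.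
have xw' := mulA_rule xw.
have xv : x * v = v * x.
  by rewrite {1}vE !(expand, xz, xz', xw, xw') !(expand, zw, zw');
     lin_decompose K T; ring: hu.
have vy : v * y = u ^+ 2 *: (y * v) - w * w.
  by rewrite {1}vE !(expand, wy') !(expand, zy, zy', wy, wy', zw, zw');
     lin_decompose K T; ring: hu.
have vy' := mulA_rule vy.
have vw : v * w = u ^+ 2 *: (w * v).
  (* Expanding both bracketings of z v y leaves (u^2 + 1) v w = u v w, and 1 - u
     is the inverse of u. *)
  have E0 : (1 - u) *: (z * v * y - z * (v * y)) = 0.
    by rewrite mulrA subrr scaler0.
  apply/eqP; rewrite -subr_eq0; apply/eqP; rewrite -[RHS]E0 zv vy.
  rewrite !(expand, zy, zy', wy, wy', zw, zw', zv, zv', vy, vy').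
  by lin_decompose K T; ring: hu.
by [].
Qed.

End ThreeRelations.
End Relations.

(** * The five-step tower *)

Lemma tri_addE (K : fieldType) (A : algType K) (p q : tri A) :
  p + q = (p.1.1 + q.1.1, p.1.2 + q.1.2, p.2 + q.2).
Proof. by case: p q => [[? ?] ?] [[? ?] ?]. Qed.
Lemma tri_oppE (K : fieldType) (A : algType K) (p : tri A) :
  - p = (- p.1.1, - p.1.2, - p.2).
Proof. by case: p => [[? ?] ?]. Qed.

Lemma homogeneous_nth (K : fieldType) (A : algType K) n
    (gens : n.-tuple (A * nat)) q g j k :
  ore_tower gens q -> (j < n)%N ->
  homogeneous gens (k * (nth g gens j).2) ((nth g gens j).1 ^+ k).
Proof.
move=> tow jn; have := homogeneous_genX (tower_deg tow) (Ordinal jn) k.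
by rewrite (tnth_nth g).
Qed.

Section Construction.
Variables (K : fieldType) (u : K).
Hypothesis hu : u ^+ 2 = u - 1.

Let u6 : u ^+ 6 = 1.
Proof. by ring: hu. Qed.

Ltac tri_solve rules :=
  rewrite !(tri_mulE, tri_scaleE, tri_addE, tri_oppE) /=; congr (_, _, _);
  rewrite ?(rules, @expand K).

(** Polynomials in y, over the base field seen as an algebra over itself. *)
Lemma ore_tower_y : exists (A : algType K) (gens : 1.-tuple (A * nat)) (y : A),
  [/\ ore_tower gens (1 - 'X), tval gens = [:: (y, 1%N)]
    & forall (T : algType K) (y' : T),
        exists g : {lrmorphism A -> T}, g y = y'].
Proof.
have base (T : algType K) : exists g : {lrmorphism K^o -> T}, True.
  suff [g _] : exists g : {lrmorphism K^o -> T}, g =1 (fun k : K^o => k%:A).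
    by exists g.
  apply: pack_lrmorphism => [k a b|]; first by rewrite scalerDl -scalerA.
  by split=> [|a b]; rewrite ?scale1r // -scalerAl mul1r scalerA.
have [phi _] := base (tri K^o).
have := @ore_tower_step _ _ _ _ _ 1 1 phi (ore_tower_base K) isT isT.
case=> [//|A [iota [y [tow _ univ]]]].
exists A, (ore_gens iota y [tuple] 1), y; split => // [|T y'].
  by rewrite mul1r in tow.
have [f _] := base T; have [//|g _ gy] := univ T f y'.
by exists g.
Qed.

Lemma ore_tower_w : exists (A : algType K) (gens : 2.-tuple (A * nat)) (y w : A),
  [/\ ore_tower gens ((1 - 'X) * (1 - 'X^3)), tval gens = [:: (y, 1%N); (w, 3)],
      rel_w u y w
    & forall (T : algType K) (y' w' : T), rel_w u y' w' ->
        exists g : {lrmorphism A -> T}, g y = y' /\ g w = w'].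
Proof.
have [R [gens [y [towR gensE univR]]]] := ore_tower_y.
have [phi phiy] := univR (tri R) (u ^+ 2 *: y, 0, y).
have [|A [iota [w [towA comm univ]]]] :=
  @ore_tower_step _ _ _ _ _ 3 6 phi towR isT isT.
  rewrite gensE /=; split=> //.
  exists (u ^+ 2); first by ring: hu.
  by exists 0; first exact: homogeneous0.
exists A, (ore_gens iota w gens 3), (iota y), w.
split=> // [||T y' w' wy]; first by rewrite /= gensE.
  by rewrite /rel_w comm phiy /= linear0 addr0 linearZ scalerAl.
have [f fy] := univR T y'.
have [|g gE gw] := univ T f w'; last by exists g; rewrite gE.
rewrite gensE /=; split=> //.
by rewrite phiy /= linear0 addr0 linearZ /= fy wy scalerAl.
Qed.

(** The term - w^2 in v y is what remains when the later variable z is moved past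
w y = u^2 y w. *)
Lemma ore_tower_v : exists (A : algType K) (gens : 3.-tuple (A * nat)) (y w v :
  A),
  [/\ ore_tower gens ((1 - 'X) * (1 - 'X^3) * (1 - 'X^5)),
      tval gens = [:: (y, 1%N); (w, 3); (v, 5)],
      rel_w u y w /\ rel_v u y w v
    & forall (T : algType K) (y' w' v' : T), rel_w u y' w' -> rel_v u y' w' v' ->
        exists g : {lrmorphism A -> T}, [/\ g y = y', g w = w' & g v = v']].
Proof.
have [R [gens [y [w [towR gensE wy univR]]]]] := ore_tower_w.
have wy' := mulA_rule wy.
have [|phi [phiy phiw]] :=
  univR (tri R) (u ^+ 2 *: y, - (w * w), y) (u ^+ 2 *: w, 0, w).
  by rewrite /rel_w; tri_solve (wy, wy'); lin_decompose K R; ring: hu.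
have [|A [iota [v [towA comm univ]]]] :=
  @ore_tower_step _ _ _ _ _ 5 6 phi towR isT isT.
  rewrite gensE /=; split; [|split=> //]; exists (u ^+ 2);
    try by ring: hu.
    exists (- (w * w)) => //; rewrite -scaleN1r; apply: homogeneousZ.
    by have := homogeneous_nth (w, 3) 2 towR (isT : (1 < 2)%N); rewrite gensE.
  by exists 0; first exact: homogeneous0.
exists A, (ore_gens iota v gens 5), (iota y), (iota w), v.
split=> // [||T y' w' v' wyT [vyT vwT]]; first by rewrite /= gensE.
  split; first by rewrite /rel_w -!rmorphM wy /= linearZ.
  rewrite /rel_v !comm phiy phiw /= linear0 addr0 !linearZ /= -!scalerAl.
  by rewrite rmorphN rmorphM.
have [f [fy fw]] := univR T y' w' wyT.
have [|g gE gv] := univ T f v'; last by exists g; rewrite !gE.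
rewrite gensE /= phiy phiw /= linear0 addr0 !linearZ /=.
by rewrite fy fw rmorphN rmorphM /= fw -!scalerAl.
Qed.

(** Adjoining z realises w and v as skew commutators: delta(y) = w and
delta(w) = v. *)
Lemma ore_tower_z : exists (A : algType K) (gens : 4.-tuple (A * nat)) (y w v z
  : A),
  [/\ ore_tower gens ((1 - 'X) * (1 - 'X^3) * (1 - 'X^5) * (1 - 'X^2)),
      tval gens = [:: (y, 1%N); (w, 3); (v, 5); (z, 2)],
      [/\ rel_w u y w, rel_v u y w v & rel_z u y w v z]
    & forall (T : algType K) (y' w' v' z' : T),
        rel_w u y' w' -> rel_v u y' w' v' -> rel_z u y' w' v' z' ->
        exists g : {lrmorphism A -> T},
          [/\ g y = y', g w = w', g v = v' & g z = z']].
Proof.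
have [R [gens [y [w [v [towR gensE [wy [vy vw]] univR]]]]]] := ore_tower_v.
have wy' := mulA_rule wy; have vy' := mulA_rule vy; have vw' := mulA_rule vw.
have [||phi [phiy phiw phiv]] :=
  univR (tri R) (y, w, y) (u *: w, v, w) (u ^+ 2 *: v, 0, v).
- by rewrite /rel_w; tri_solve (wy, wy', vy, vy', vw, vw'); lin_decompose K R;
  ring: hu.
- by rewrite /rel_v; split; tri_solve (wy, wy', vy, vy', vw, vw');
  lin_decompose K R; ring: hu.
have [|A [iota [z [towA comm univ]]]] :=
  @ore_tower_step _ _ _ _ _ 2 6 phi towR isT isT.
  rewrite gensE /=; split; [|split; [|split=> //]].
  - exists 1; first exact: expr1n.
    exists w; last by rewrite scale1r.
    by have := homogeneous_nth (w, 3) 1 towR (isT : (1 < 3)%N); rewrite gensE.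
  - exists u => //; exists v => //.
    by have := homogeneous_nth (w, 3) 1 towR (isT : (2 < 3)%N); rewrite gensE.
  - exists (u ^+ 2); first by ring: hu.
    by exists 0; first exact: homogeneous0.
exists A, (ore_gens iota z gens 2), (iota y), (iota w), (iota v), z.
split=> // [||T y' w' v' z' wyT vT [zyT zwT zvT]]; first by rewrite /= gensE.
  split; first by rewrite /rel_w -!rmorphM wy /= linearZ.
    by rewrite /rel_v -!rmorphM vy vw /= linearB !linearZ /= !rmorphM.
  by split; rewrite comm ?phiy ?phiw ?phiv /= ?linear0 ?addr0
    ?linearZ //= -!scalerAl.
have [f [fy fw fv]] := univR T y' w' v' wyT vT.
have [|g gE gz] := univ T f z'; last by exists g; rewrite !gE.
rewrite gensE /= phiy phiw phiv /= linear0 addr0 !linearZ /=.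
by rewrite fy fw fv -!scalerAl.
Qed.

(** Adjoining x realises z as a skew commutator. Only x and y are tracked in the
universal property, as they determine w, v, z. *)
Lemma ore_tower_x : exists (A : algType K) (gens : 5.-tuple (A * nat)) (y w v z
  x : A),
  [/\ ore_tower gens
        ((1 - 'X) * (1 - 'X^3) * (1 - 'X^5) * (1 - 'X^2) * (1 - 'X)),
      tval gens = [:: (y, 1%N); (w, 3); (v, 5); (z, 2); (x, 1%N)],
      [/\ rel_w u y w, rel_v u y w v, rel_z u y w v z & rel_x u y w v z x]
    & forall (T : algType K) (y' w' v' z' x' : T),
        rel_w u y' w' -> rel_v u y' w' v' -> rel_z u y' w' v' z' ->
        rel_x u y' w' v' z' x' ->
        exists g : {lrmorphism A -> T}, g y = y' /\ g x = x'].
Proof.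
have [R [gens [y [w [v [z [towR gensE [wy [vy vw] [zy zw zv]] univR]]]]]]] :=
  ore_tower_z.
have wy' := mulA_rule wy; have vy' := mulA_rule vy; have vw' := mulA_rule vw.
have zy' := mulA_rule zy; have zw' := mulA_rule zw; have zv' := mulA_rule zv.
have [|||phi [phiy phiw phiv phiz]] :=
  univR (tri R) (- u *: y, z, y) (- u ^+ 2 *: w, u ^+ 2 *: (z * z), w)
     (v, 0, v) (u *: z, 0, z).
- by rewrite /rel_w;
  tri_solve (wy, wy', vy, vy', vw, vw', zy, zy', (zw, zw', zv, zv'));
   lin_decompose K R; ring: hu.
- by rewrite /rel_v; split;
  tri_solve (wy, wy', vy, vy', vw, vw', zy, zy', (zw, zw', zv, zv'));
    lin_decompose K R; ring: hu.
- by rewrite /rel_z; split;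
  tri_solve (wy, wy', vy, vy', vw, vw', zy, zy', (zw, zw', zv, zv'));
    lin_decompose K R; ring: hu.
have [|A [iota [x [towA comm univ]]]] :=
  @ore_tower_step _ _ _ _ _ 1 6 phi towR isT isT.
  rewrite gensE /=; split; [|split; [|split; [|split=> //]]].
  - exists (- u); first by ring: hu.
    exists z => //.
    by have := homogeneous_nth (w, 3) 1 towR (isT : (3 < 4)%N); rewrite gensE.
  - exists (- u ^+ 2); first by ring: hu.
    exists (u ^+ 2 *: (z * z)) => //; apply: homogeneousZ.
    by have := homogeneous_nth (w, 3) 2 towR (isT : (3 < 4)%N); rewrite gensE.
  - exists 1; first exact: expr1n.
    exists 0; first exact: homogeneous0.
    by rewrite scale1r.
  - by exists u => //; exists 0; first exact: homogeneous0.
exists A, (ore_gens iota x gens 1), (iota y), (iota w), (iota v), (iota z), x.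
split=> // [||T y' w' v' z' x' wyT vT zT [xyT xwT xvT xzT]].
- by rewrite /= gensE.
- split.
  + by rewrite /rel_w -!rmorphM wy /= linearZ.
  + by rewrite /rel_v -!rmorphM vy vw /= linearB !linearZ /= !rmorphM.
  + by rewrite /rel_z -!rmorphM zy zw zv /= !linearD !linearZ /= !rmorphM.
  + by split; rewrite comm ?phiy ?phiw ?phiv ?phiz /= ?linear0 ?addr0
    ?linearZ //= ?linearZ /= ?rmorphM -!scalerAl.
have [f [fy fw fv fz]] := univR T y' w' v' z' wyT vT zT.
have [|g gE gx] := univ T f x'; last by exists g; rewrite !gE.
rewrite gensE /= phiy phiw phiv phiz /= linear0 !addr0 !linearZ /=.
by rewrite rmorphM /= fy fw fv fz -!scalerAl.
Qed.

End Construction.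

(** * Quotient algebras and free algebras *)

Section QuotientAlgebra.
Variables (K : fieldType) (F : lalgType K) (I : F -> Prop).
Hypothesis scaleAr : forall (k : K) (a b : F), k *: (a * b) = a * (k *: b).
Hypothesis idI : is_two_sided_ideal I.
Hypothesis I1 : ~ I 1.

Let I_D a b : I a -> I b -> I (a + b). Proof. by case: idI => _ + _; apply. Qed.
Let I_Ml a b : I b -> I (a * b).
Proof. by case: idI => _ _ /(_ a b 1) + Ib => /(_ Ib); rewrite mulr1. Qed.
Let I_Mr a b : I a -> I (a * b).
Proof. by case: idI => _ _ /(_ 1 a b) + Ia => /(_ Ia); rewrite mul1r. Qed.
Let I_Z (k : K) a : I a -> I (k *: a).
Proof. by rewrite -mulr_algl; apply: I_Ml. Qed.

(** Membership is made boolean classically, to use effective quotients. *)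
Definition ideal_pred of is_two_sided_ideal I : {pred F} :=
  fun f => `[< I f >].

Fact ideal_pred_zmod_closed : zmod_closed (ideal_pred idI).
Proof.
split=> [|a b /asboolP Ia /asboolP Ib]; apply/asboolP; first by case: idI.
by apply: I_D => //; rewrite -mulN1r; apply: I_Ml.
Qed.
HB.instance Definition _ :=
  GRing.isZmodClosed.Build F (ideal_pred idI) ideal_pred_zmod_closed.

Definition quotient_algebra := Quotient.quot (ideal_pred idI : zmodClosed F).
Local Notation Q := quotient_algebra.
HB.instance Definition _ := GRing.Zmodule.on Q.

Definition qpi (a : F) : Q := (\pi a)%qT.
Definition qrepr (x : Q) : F := repr x.

Lemma qreprK x : qpi (qrepr x) = x.
Proof. exact: reprK. Qed.

Lemma qpi_eq a b : qpi a = qpi b <-> I (a - b).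
Proof.
split=> [/eqP|Iab]; first by rewrite -Quotient.idealrBE => /asboolP.
by apply/eqP; rewrite -Quotient.idealrBE; apply/asboolP.
Qed.

Lemma qpiB : zmod_morphism qpi.
Proof. exact: raddfB. Qed.
HB.instance Definition _ := GRing.isZmodMorphism.Build F Q qpi qpiB.

Definition qmul (x y : Q) : Q := qpi (qrepr x * qrepr y).
Definition qscale (k : K) (x : Q) : Q := qpi (k *: qrepr x).

Lemma qrepr_pi a : I (qrepr (qpi a) - a).
Proof. by apply/qpi_eq; rewrite qreprK. Qed.

Lemma qmulE a b : qmul (qpi a) (qpi b) = qpi (a * b).
Proof.
apply/qpi_eq; set a' := qrepr _; set b' := qrepr _.
have -> : a' * b' - a * b = (a' - a) * b' + a * (b' - b).
  by rewrite mulrBl mulrBr addrA subrK.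
by apply: I_D; [apply: I_Mr | apply: I_Ml]; apply: qrepr_pi.
Qed.

Lemma qscaleE k a : qscale k (qpi a) = qpi (k *: a).
Proof. by apply/qpi_eq; rewrite -scalerBr; apply/I_Z/qrepr_pi. Qed.

Lemma qpi_ind (P : Q -> Prop) : (forall a, P (qpi a)) -> forall x, P x.
Proof. by move=> Pp x; rewrite -(qreprK x). Qed.

Fact qmulA : associative qmul.
Proof.
by elim/qpi_ind => a; elim/qpi_ind => b; elim/qpi_ind => c; rewrite !qmulE mulrA.
Qed.
Fact qmul1l : left_id (qpi 1) qmul.
Proof. by elim/qpi_ind => a; rewrite qmulE mul1r. Qed.
Fact qmul1r : right_id (qpi 1) qmul.
Proof. by elim/qpi_ind => a; rewrite qmulE mulr1. Qed.
Fact qmulDl : left_distributive qmul +%R.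
Proof.
elim/qpi_ind => a; elim/qpi_ind => b; elim/qpi_ind => c.
by rewrite -raddfD !qmulE mulrDl raddfD.
Qed.
Fact qmulDr : right_distributive qmul +%R.
Proof.
elim/qpi_ind => a; elim/qpi_ind => b; elim/qpi_ind => c.
by rewrite -raddfD !qmulE mulrDr raddfD.
Qed.
Fact qpi1_neq0 : qpi 1 != 0.
Proof. by apply/eqP; rewrite -(raddf0 qpi) => /qpi_eq; rewrite subr0. Qed.
HB.instance Definition _ := GRing.Zmodule_isNzRing.Build Q
  qmulA qmul1l qmul1r qmulDl qmulDr qpi1_neq0.

Fact qscaleA k l x : qscale k (qscale l x) = qscale (k * l) x.
Proof. by elim/qpi_ind: x => a; rewrite !qscaleE scalerA. Qed.
Fact qscale1 : left_id 1 qscale.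
Proof. by elim/qpi_ind => a; rewrite qscaleE scale1r. Qed.
Fact qscaleDr : right_distributive qscale +%R.
Proof.
move=> k; elim/qpi_ind => a; elim/qpi_ind => b.
by rewrite -raddfD !qscaleE scalerDr raddfD.
Qed.
Fact qscaleDl x : {morph qscale^~ x : k l / k + l}.
Proof. by elim/qpi_ind: x => a k l; rewrite !qscaleE scalerDl raddfD. Qed.
HB.instance Definition _ := GRing.Zmodule_isLmodule.Build K Q
  qscaleA qscale1 qscaleDr qscaleDl.
Fact qscaleAl k x y : qscale k (qmul x y) = qmul (qscale k x) y.
Proof.
elim/qpi_ind: x => a; elim/qpi_ind: y => b.
by rewrite qmulE !qscaleE qmulE scalerAl.
Qed.
HB.instance Definition _ := GRing.Lmodule_isLalgebra.Build K Q qscaleAl.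
Fact qscaleAr k x y : qscale k (qmul x y) = qmul x (qscale k y).
Proof.
elim/qpi_ind: x => a; elim/qpi_ind: y => b.
by rewrite qmulE !qscaleE qmulE scaleAr.
Qed.
HB.instance Definition _ := GRing.Lalgebra_isAlgebra.Build K Q qscaleAr.

Theorem quotient_algebra_exists :
  exists (B : algType K) (p : {lrmorphism F -> B}), forall f, p f = 0 <-> I f.
Proof.
have plin : linear (qpi : F -> Q).
  by move=> k a b; rewrite raddfD -[k *: qpi a]/(qscale k (qpi a)) qscaleE.
have pmon : monoid_morphism (qpi : F -> Q) by split=> // a b; rewrite -qmulE.
have [p pE] := pack_lrmorphism plin pmon.
by exists Q, p => f; rewrite pE -(raddf0 qpi) qpi_eq subr0.
Qed.

End QuotientAlgebra.

Section FreeAlgebra.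
Variables (K : fieldType) (b : nat).
Local Notation F := (free_algebra K b).
Implicit Types f g : F.

(** The free algebra carries a left algebra structure; this is the other half of
the algebra axioms, true because K is commutative. *)
Lemma free_scalerAr (k : K) f g : k *: (f * g) = f * (k *: g).
Proof.
apply/malgP => w; rewrite mcoeffZ.
have E := @mcoeffMlw {fmonom 'I_b} K _ _ f (k *: g) w (fsubset_refl _)
  (msuppZ_le k g).
rewrite [RHS]E [X in _ * X](@mcoeffMl {fmonom 'I_b} K f g w) mulr_sumr.
apply: eq_bigr => k1 _; rewrite mulr_sumr.
by apply: eq_bigr => k2 _; rewrite mcoeffZ mulrnAr mulrCA.
Qed.

Lemma free_algebra_ind (P : F -> Prop) :
  subalgebra P -> (forall i, P << fmu i >>) -> forall f, P f.
Proof.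
move=> sP Pg f; case: (sP) => P1 PD PM; rewrite [f]monalgE.
elim/big_rec: _ => [|w g _ Pg']; first exact: subalgebra0.
have -> : << f@_w *g w >> = f@_w *: << w >> :> F.
  by apply/malgP => w';
    rewrite mcoeffZ [LHS]mcoeffU [X in _ * X]mcoeffU mulrnAr mulr1.
apply: PD => //; case: w => s; elim: s => [|i s IH].
  by have -> : FMonom [::] = mone :> {fmonom 'I_b} by apply: val_inj;
    rewrite [RHS]fm1.
have -> : FMonom (i :: s) = mmul (fmu i) (FMonom s).
  by apply: val_inj; rewrite [RHS]fmM fmU.
have -> : << mmul (fmu i) (FMonom s) >> = << fmu i >> * << FMonom s >> :> F.
  by rewrite [RHS]fgmulUU mulr1.
exact: PM.
Qed.

Lemma free_algebra_universal (T : algType K) (t : 'I_b -> T) :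
  exists phi : {lrmorphism F -> T}, forall i, phi << fmu i >> = t i.
Proof.
pose h (w : {fmonom 'I_b}) : T := \prod_(i <- (w : seq 'I_b)) t i.
have hM : mmorphism h.
  by split=> [w w'|]; rewrite /h ?fm1 ?big_nil // fmM big_cat.
pose hh : {mmorphism {fmonom 'I_b} -> T} :=
  HB.pack h (monalg.isMultiplicative.Build {fmonom 'I_b} T h hM).
pose phi := mmap (in_alg T) hh.
have lin : linear (phi : F -> T).
  by move=> k f g; rewrite /phi mmapD mmapZ mulr_algl.
have mon : monoid_morphism (phi : F -> T).
  have [] := @commr_mmap_is_multiplicative _ _ _ (in_alg T) hh _ => //.
  by move=> g m m'; rewrite /GRing.comm mulr_algl mulr_algr.
have [psi psiE] := pack_lrmorphism lin mon.
exists psi => i; rewrite psiE /phi mmapU /= scale1r mul1r.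
by rewrite /h fmU big_seq1.
Qed.

Lemma free_homogeneous_gen i : free_homogeneous 1 (<< fmu i >> : F).
Proof.
move=> w; rewrite mcoeffU; have [<- _|_] := eqVneq (fmu i) w.
  by rewrite fdegU.
by rewrite mulr0n eqxx.
Qed.

Lemma free_homogeneousD m f g :
  free_homogeneous m f -> free_homogeneous m g -> free_homogeneous m (f + g).
Proof.
move=> hf hg w; rewrite mcoeffD; have [f0|] := eqVneq f@_w 0.
  by rewrite f0 add0r; apply: hg.
by move=> /hf.
Qed.

Lemma free_homogeneousZ m (k : K) f :
  free_homogeneous m f -> free_homogeneous m (k *: f).
Proof. by move=> hf w; rewrite mcoeffZ mulf_eq0 negb_or => /andP[_ /hf]. Qed.

Lemma free_homogeneousB m f g :
  free_homogeneous m f -> free_homogeneous m g -> free_homogeneous m (f - g).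
Proof.
by move=> hf hg; rewrite -scaleN1r; apply/free_homogeneousD/free_homogeneousZ.
Qed.

Lemma free_homogeneousM m n f g :
  free_homogeneous m f -> free_homogeneous n g -> free_homogeneous (m + n) (f *
    g).
Proof.
move=> hf hg w; rewrite mcoeff_neq0 => /msuppM_le[k1 [k2 []]].
by rewrite -!mcoeff_neq0 => /hf <- /hg <- ->; rewrite fdegM.
Qed.

End FreeAlgebra.

(** If rho kills all generators but the j-th, its kernel is an ideal that contains
the others and not the j-th, which therefore cannot be omitted. *)
Lemma minimal_by_separation (K : fieldType) (F : lalgType K) k (r : 'I_k -> F)
    (I : F -> Prop) :
  (forall f, ideal_generated_by (fun g => exists2 j, j \in [set: 'I_k] & g = r
    j) f
     <-> I f) ->
  (forall j, exists (B : algType K) (rho : {lrmorphism F -> B}),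
     (forall i, i != j -> rho (r i) = 0) /\ rho (r j) != 0) ->
  is_minimal_generating_family I r.
Proof.
move=> gen sep; split=> // J Jgen; apply/setP => j; rewrite in_setT.
apply/negPn/negP => jJ.
have [B [rho [rho0 /eqP]]] := sep j; apply.
have Irj : I (r j) by apply/gen => I' idI' /(_ (r j)); apply; exists j.
move/Jgen: Irj => /(_ (fun f => rho f = 0)); apply=> [|g [i iJ ->]].
  split=> [|f g ef eg|a f c ef]; first exact: rmorph0.
    by rewrite rmorphD /= ef eg addr0.
  by rewrite !rmorphM /= ef mulr0 mul0r.
by apply: rho0; apply: contraNneq jJ => <-.
Qed.

(** * The three relators and their independence *)

Section Relators.
Variables (K : fieldType) (u : K).

Section Def.
Variables (T : lalgType K) (x y : T).
(** The variables z, w, v as skew commutators; the relators are the commutation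
rules of x with z, of w with y and of z with v. *)
Definition com_z := x * y + u *: (y * x).
Definition com_w := com_z * y - y * com_z.
Definition com_v := com_z * com_w - u *: (com_w * com_z).
Definition relator3 := x * com_z - u *: (com_z * x).
Definition relator4 := com_w * y - u ^+ 2 *: (y * com_w).
Definition relator7 := com_z * com_v - u ^+ 2 *: (com_v * com_z).
Definition relators := [:: relator3; relator4; relator7].
End Def.

Lemma relators_morph (S T : lalgType K) (f : {lrmorphism S -> T}) x y j :
  f (nth 0 (relators x y) j) = nth 0 (relators (f x) (f y)) j.
Proof.
have fz : f (com_z x y) = com_z (f x) (f y).
  by rewrite linearD linearZ /= !rmorphM.
have fw : f (com_w x y) = com_w (f x) (f y).
  by rewrite linearB /= !rmorphM /= fz.
have fv : f (com_v x y) = com_v (f x) (f y).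
  by rewrite linearB linearZ /= !rmorphM /= fz fw.
case: j => [|[|[|j]]] /=; last by rewrite !nth_nil rmorph0.
- by rewrite linearB linearZ /= !rmorphM /= fz.
- by rewrite linearB linearZ /= !rmorphM /= fw.
by rewrite linearB linearZ /= !rmorphM /= fz fv.
Qed.

Section Homogeneity.
Variables (b : nat) (x y : free_algebra K b).
Hypotheses (hx : free_homogeneous 1 x) (hy : free_homogeneous 1 y).

Let hz : free_homogeneous 2 (com_z x y).
Proof.
apply: (free_homogeneousD (free_homogeneousM hx hy)).
exact: (@free_homogeneousZ _ _ _ _ _ (free_homogeneousM hy hx)).
Qed.
Let hw : free_homogeneous 3 (com_w x y).
Proof.
exact: (free_homogeneousB (free_homogeneousM hz hy) (free_homogeneousM hy hz)).
Qed.
Let hv : free_homogeneous 5 (com_v x y).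
Proof.
apply: (free_homogeneousB (free_homogeneousM hz hw)).
exact: (@free_homogeneousZ _ _ _ _ _ (free_homogeneousM hw hz)).
Qed.

Lemma relator3_homogeneous : free_homogeneous 3 (relator3 x y).
Proof.
apply: (free_homogeneousB (free_homogeneousM hx hz)).
exact: (@free_homogeneousZ _ _ _ _ _ (free_homogeneousM hz hx)).
Qed.
Lemma relator4_homogeneous : free_homogeneous 4 (relator4 x y).
Proof.
apply: (free_homogeneousB (free_homogeneousM hw hy)).
exact: (@free_homogeneousZ _ _ _ _ _ (free_homogeneousM hy hw)).
Qed.
Lemma relator7_homogeneous : free_homogeneous 7 (relator7 x y).
Proof.
apply: (free_homogeneousB (free_homogeneousM hz hv)).
exact: (@free_homogeneousZ _ _ _ _ _ (free_homogeneousM hv hz)).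
Qed.
End Homogeneity.

End Relators.

Section MatrixUnits.
Variables (K : fieldType) (n : nat).

(** Matrix units, indexed by natural numbers at most n so that products reduce by
computation. *)
Definition munit (i j : nat) : 'M[K]_n.+1 := delta_mx (inord i) (inord j).

Lemma munitM i j k l : (j <= n)%N -> (k <= n)%N ->
  munit i j * munit k l = if j == k then munit i l else 0.
Proof.
move=> jn kn; rewrite /munit -[LHS]/(_ *m _) mul_delta_mx_cond.
rewrite -val_eqE /= !inordK ?ltnS //; case: eqP => _; first by rewrite mulr1n.
by rewrite mulr0n.
Qed.

Lemma munit_neq0 i j : munit i j != 0.
Proof.
apply/eqP => /matrixP/(_ (inord i) (inord j)).
by rewrite !mxE !eqxx => /eqP; rewrite oner_eq0.
Qed.
End MatrixUnits.

Section Separation.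
Variables (K : fieldType) (u : K).
Hypothesis hu : u ^+ 2 = u - 1.

Let u_neq0 : u != 0.
Proof.
apply/eqP => u0; move: hu; rewrite u0 expr0n /= sub0r => /eqP.
by rewrite eq_sym oppr_eq0 oner_eq0.
Qed.

(** Take y = e01 and x = e11, so that y^2 = y x y = 0 and x is idempotent: every
word in which y occurs twice vanishes, while x^2 y = 0 and y x^2 = y. *)
Lemma separate3 : exists (B : algType K) (x y : B),
  [/\ relator3 u x y != 0, relator4 u x y = 0 & relator7 u x y = 0].
Proof.
exists 'M[K]_2, (munit K 1 1 1), (munit K 1 0 1).
have zE : com_z u (munit K 1 1 1) (munit K 1 0 1) = u *: munit K 1 0 1.
  by rewrite /com_z !munitM //= add0r.
have wE : com_w u (munit K 1 1 1) (munit K 1 0 1) = 0.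
  by rewrite /com_w zE -scalerAl -scalerAr !munitM //= scaler0 subrr.
have vE : com_v u (munit K 1 1 1) (munit K 1 0 1) = 0.
  by rewrite /com_v wE mulr0 mul0r scaler0 subrr.
rewrite /relator3 /relator4 /relator7 zE wE vE !(mul0r, mulr0, scaler0, subrr).
split=> //; rewrite -scalerAl -scalerAr !munitM //= scaler0 sub0r scalerA.
by rewrite oppr_eq0 scaler_eq0 mulf_eq0 (negPf u_neq0) (negPf (munit_neq0 _ _ _
  _)).
Qed.

(** Take x = e01 and y = e11: every word in which x occurs twice vanishes, while
x y^3 = x and y^3 x = 0. *)
Lemma separate4 : exists (B : algType K) (x y : B),
  [/\ relator3 u x y = 0, relator4 u x y != 0 & relator7 u x y = 0].
Proof.
exists 'M[K]_2, (munit K 1 0 1), (munit K 1 1 1).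
have zE : com_z u (munit K 1 0 1) (munit K 1 1 1) = munit K 1 0 1.
  by rewrite /com_z !munitM //= scaler0 addr0.
have wE : com_w u (munit K 1 0 1) (munit K 1 1 1) = munit K 1 0 1.
  by rewrite /com_w zE !munitM //= subr0.
have vE : com_v u (munit K 1 0 1) (munit K 1 1 1) = 0.
  by rewrite /com_v wE zE !munitM //= scaler0 subrr.
rewrite /relator3 /relator4 /relator7 zE wE vE !(mul0r, mulr0, scaler0, subrr).
by rewrite !munitM //= !scaler0 !subr0 munit_neq0.
Qed.

(** The relators of degrees 3 and 4 are x^2 y - u^2 y x^2 and x y^3 - y^3 x, so they
vanish as soon as x^2 = 0 and y^3 = 0. With x = e10 and y = e01 + e12 the word
x y x y x y^2 does not vanish, and the relator of degree 7 becomes e12. *)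
Lemma separate7 : exists (B : algType K) (x y : B),
  [/\ relator3 u x y = 0, relator4 u x y = 0 & relator7 u x y != 0].
Proof.
pose e := munit K 2; pose x : 'M[K]_3 := e 1%N 0%N.
pose y : 'M[K]_3 := e 0%N 1%N + e 1%N 2.
exists 'M[K]_3, x, y.
have zE : com_z u x y = e 1%N 1%N + u *: e 0%N 0%N.
  by rewrite /com_z /x /y mulrDr mulrDl !munitM //= !addr0.
have wE : com_w u x y = e 1%N 2 + (u - 1) *: e 0%N 1%N.
  rewrite /com_w zE /y !(mulrDl, mulrDr) -!scalerAl -!scalerAr !munitM //=.
  rewrite !(addr0, add0r, scaler0) scalerBl scale1r.
  by lin_decompose K 'M[K]_3; ring.
have vE : com_v u x y = e 1%N 2.
  rewrite /com_v zE wE !(mulrDl, mulrDr) -!scalerAl -!scalerAr !munitM //=.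
  rewrite !(addr0, add0r, scaler0) scalerA.
  by lin_decompose K 'M[K]_3; ring.
rewrite /relator3 /relator4 /relator7 vE zE wE /x /y.
rewrite !(mulrDl, mulrDr) -!scalerAl -!scalerAr !munitM //=.
rewrite !(addr0, add0r, scaler0, subr0).
split; last exact: munit_neq0; last by rewrite hu subrr.
by rewrite subrr.
Qed.

End Separation.

(** * Presentation of the tower and conclusion *)

(** The root is (1 + s) / 2 with s a square root of -3. *)
Lemma sixth_root (R : realType) (K : fieldType) (embC : {rmorphism R[i] -> K}) :
  exists u : K, u ^+ 2 = u - 1.
Proof.
pose s : R[i] := Num.Theory.nthroot 2 (- 3%:R).
have sE : s ^+ 2 = - 3%:R by apply: Num.Theory.rootCK.
exists (embC ((1 + s) / 2%:R)).
rewrite -rmorphXn -(rmorph1 embC) -rmorphB; congr (embC _).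
by field: sE.
Qed.

Section RelationType.
Variables (K : fieldType) (u : K).
Hypothesis hu : u ^+ 2 = u - 1.

Lemma relator_relations (T : algType K) (y w v z x : T) :
  rel_w u y w -> rel_z u y w v z -> rel_x u y w v z x ->
  [/\ z = com_z u x y, w = com_w u x y & v = com_v u x y] /\
  [/\ relator3 u x y = 0, relator4 u x y = 0 & relator7 u x y = 0].
Proof.
move=> wy [zy zw zv] [xy _ _ xz].
have zE : z = com_z u x y by rewrite /com_z xy scaleNr addrAC addNr add0r.
have wE : w = com_w u x y by rewrite /com_w -zE zy addrC addKr.
have vE : v = com_v u x y by rewrite /com_v -zE -wE zw addrC addKr.
split=> //; rewrite /relator3 /relator4 /relator7 -zE -wE -vE.
by rewrite xz wy zv !subrr.
Qed.

Lemma relations_of_relators (T : algType K) (x y : T) :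
  relator3 u x y = 0 -> relator4 u x y = 0 -> relator7 u x y = 0 ->
  let z := com_z u x y in let w := com_w u x y in let v := com_v u x y in
  [/\ rel_w u y w, rel_v u y w v, rel_z u y w v z & rel_x u y w v z x].
Proof.
move=> /eqP; rewrite subr_eq0 => /eqP r3 /eqP; rewrite subr_eq0 => /eqP r4.
move=> /eqP; rewrite subr_eq0 => /eqP r7 z w v.
have xy : x * y = - u *: (y * x) + z by rewrite /z /com_z scaleNr addrC addrK.
have zy : z * y = y * z + w by rewrite /w /com_w addrC subrK.
have zw : z * w = u *: (w * z) + v by rewrite /v /com_v addrC subrK.
have [hv hx] := three_relations hu xy zy zw r3 r4 r7.
by split=> //; split.
Qed.

(** An algebra generated by x and y in degree one and universal for the three
relators is presented by them. *)
Lemma relation_type_of_universal (A : algType K) n (gens : n.-tuple (A * nat))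
    (x y : A) :
  has_dim (homogeneous gens 1) 2 ->
  homogeneous gens 1 x -> homogeneous gens 1 y ->
  (forall P, subalgebra P -> P x -> P y -> forall a, P a) ->
  [/\ relator3 u x y = 0, relator4 u x y = 0 & relator7 u x y = 0] ->
  (forall (T : algType K) (x' y' : T),
     [/\ relator3 u x' y' = 0, relator4 u x' y' = 0 & relator7 u x' y' = 0] ->
     exists g : {lrmorphism A -> T}, g x = x' /\ g y = y') ->
  relation_type gens [:: 3; 4; 7]%N.
Proof.
move=> dim1 hx hy gen [r3 r4 r7] univ; split=> //.
have i2 (i : 'I_2) : i = 0 \/ i = 1.
  by case: i => [[|[|//]] ?]; [left|right]; apply: val_inj.
pose t (T : Type) (a b : T) (i : 'I_2) := if i == 0 then a else b.
have [phi phiE] := free_algebra_universal (t A x y).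
pose X : free_algebra K 2 := << fmu 0 >>; pose Y : free_algebra K 2 :=
  << fmu 1 >>.
have phiX : phi X = x by rewrite phiE.
have phiY : phi Y = y by rewrite phiE.
pose r (j : 'I_3) := nth 0 (relators u X Y) j.
exists 2, phi, r; split=> //.
- by move=> i; case: (i2 i) => ->; rewrite phiE.
- apply: gen.
  + split=> [|k _ _ [f <-] [g <-]|_ _ [f <-] [g <-]].
    * by exists 1; rewrite rmorph1.
    * by exists (k *: f + g); rewrite linearP.
    * by exists (f * g); rewrite rmorphM.
  + by exists X.
  + by exists Y.
- have hX : free_homogeneous 1 X := @free_homogeneous_gen K 2 0.
  have hY : free_homogeneous 1 Y := @free_homogeneous_gen K 2 1.
  case=> [[|[|[|//]]] ?]; rewrite /r.
  + exact: relator3_homogeneous hX hY.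
  + exact: relator4_homogeneous hX hY.
  + exact: relator7_homogeneous hX hY.
have phir j : phi (r j) = 0.
  rewrite /r relators_morph phiX phiY /relators r3 r4 r7.
  by case: j => [[|[|[|//]]] ?].
apply: minimal_by_separation => [f|j].
  split=> [If|phif0 I idI Ir].
    apply: (If (fun f => phi f = 0)) => [|_ [j _ ->]]; last exact: phir.
    split=> [|g h eg eh|g h k eh]; first exact: rmorph0.
      by rewrite rmorphD /= eg eh addr0.
    by rewrite !rmorphM /= eh mulr0 mul0r.
  have [I1|nI1] := pselect (I 1).
    by case: idI => _ _ /(_ f 1 1 I1); rewrite !mulr1.
  have [Q [p pI]] := quotient_algebra_exists (@free_scalerAr K 2) idI nI1.
  have pr j : nth 0 (relators u (p X) (p Y)) j = 0.
    rewrite -relators_morph; apply/pI.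
    have [j3|j3] := ltnP j 3; last by rewrite nth_default //; case: idI.
    by apply: Ir; exists (Ordinal j3).
  have [|g [gX gY]] := univ Q (p X) (p Y).
    by split; [exact: (pr 0%N) | exact: (pr 1%N) | exact: (pr 2)].
  apply/pI; rewrite -(rmorph0 g) -phif0.
  move: f {phif0}; apply: free_algebra_ind => [|i].
    split=> [|k a b ea eb|a b ea eb]; first by rewrite !rmorph1.
      by rewrite [phi _]linearP [LHS]linearP [RHS]linearP /= ea eb.
    by rewrite [phi _]rmorphM [LHS]rmorphM [RHS]rmorphM /= ea eb.
  by case: (i2 i) => ->; rewrite -/X -/Y ?phiX ?phiY.
have [B [x' [y' sep]]] : exists (B : algType K) (x' y' : B),
    (forall i : 'I_3, i != j -> nth 0 (relators u x' y') i = 0)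
    /\ nth 0 (relators u x' y') j != 0.
  case: j => [[|[|[|//]]] j3].
  - have [B [x' [y' [s3 s4 s7]]]] := separate3 hu.
    by exists B, x', y'; split=> //; case=> [[|[|[|//]]] ?].
  - have [B [x' [y' [s3 s4 s7]]]] := separate4 u.
    by exists B, x', y'; split=> //; case=> [[|[|[|//]]] ?].
  - have [B [x' [y' [s3 s4 s7]]]] := separate7 hu.
    by exists B, x', y'; split=> //; case=> [[|[|[|//]]] ?].
have [rho rhoE] := free_algebra_universal (t B x' y').
have rhoX : rho X = x' by rewrite rhoE.
have rhoY : rho Y = y' by rewrite rhoE.
exists B, rho; rewrite /r relators_morph rhoX rhoY; split; last exact: sep.2.
by move=> i ij; rewrite relators_morph rhoX rhoY; apply: sep.1.
Qed.

End RelationType.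

Theorem theorem1p1 (R : realType) (K : fieldType)
    (embC : {rmorphism R[i] -> K}) :
  exists (A : algType K) (n : nat) (gens : n.-tuple (A * nat)),
    [/\ AS_Ore_extension gens,
        has_dim (homogeneous gens 1) 2,
        hilbert_series_is_inv gens
          ((1 - 'X) ^+ 2 * (1 - 'X^2) * (1 - 'X^3) * (1 - 'X^5))
      & relation_type gens [:: 3; 4; 7]%N].
Proof.
have [u hu] := sixth_root embC.
have [A [gens [y [w [v [z [x [tow gensE [wy _ zr xr] univ]]]]]]]] :=
  ore_tower_x hu.
have [[zE wE vE] rels] := relator_relations wy zr xr.
have hx : homogeneous gens 1 x.
  by have := homogeneous_nth (x, 1%N) 1 tow (isT : (4 < 5)%N); rewrite gensE.
have hy : homogeneous gens 1 y.
  by have := homogeneous_nth (x, 1%N) 1 tow (isT : (0 < 5)%N); rewrite gensE.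
have gen (P : A -> Prop) : subalgebra P -> P x -> P y -> forall a, P a.
  move=> sP Px Py; case: (sP) => P1 PD PM.
  have PB a b : P a -> P b -> P (a - b).
    by move=> Pa Pb; rewrite addrC -scaleN1r; apply: PD.
  have PZ k a : P a -> P (k *: a).
    by move=> Pa; rewrite -[_ *: _]addr0; apply: PD => //; apply: subalgebra0.
  have Pz : P z by rewrite zE /com_z addrC; apply: PD; apply: PM.
  have Pw : P w by rewrite wE /com_w -zE; apply: PB; apply: PM.
  have Pv : P v by rewrite vE /com_v -zE -wE; apply: PB; last apply: PZ;
    apply: PM.
  apply: (tower_gen tow sP); apply: (@all_prop_tnth _ _ gens (fun g => P g.1)).
  by rewrite gensE.
have qE : (1 - 'X) * (1 - 'X^3) * (1 - 'X^5) * (1 - 'X^2) * (1 - 'X) =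
    (1 - 'X) ^+ 2 * (1 - 'X^2) * (1 - 'X^3) * (1 - 'X^5) :> {poly int} by ring.
have [h hdim hser] := tower_hilb tow; rewrite qE in hser.
have dim1 : has_dim (homogeneous gens 1) 2.
  suff h1 : h 1%N = 2%N by move: (hdim 1%N); rewrite h1.
  set q := (_ * _) in hser.
  (* The expanded denominator, of which only the terms of degree at most 1 matter
     for the dimension of A_1. *)
  have {}qE : q = 1 - 2%:R *: 'X + 'X^2 * ('X + 'X^2 - 'X^3 + 'X^5 - 'X^6
      - 'X^7 + 2%:R *: 'X^9 - 'X^10) by rewrite /q -!mul_polyC !rmorphMn /=; ring.
  have q0 : q`_0 = 1 by rewrite qE coefD coefXnM !(coefB, coefZ, coefX, coef1).
  have q1 : q`_1 = - 2%:R by rewrite qE coefD coefXnM !(coefB, coefZ, coefX,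
    coef1).
  have := hser 0%N; have := hser 1%N.
  rewrite !big_ord_recl !big_ord0 /= q0 q1 -[bump 0 0]/1%N !subn0 subnn; lia.
exists A, 5, gens; split=> //.
- split; first exact: tower_ore tow.
  move=> P Ph P1 PD PM; apply: gen; first by split.
    exact: Ph.
  exact: Ph.
- by exists h.
apply: (@relation_type_of_universal K u hu A 5 gens x y) => // T x' y' [r3 r4 r7].
have [wyT vT zT xT] := relations_of_relators hu r3 r4 r7.
by have [g [gy gx]] := univ T _ _ _ _ _ wyT vT zT xT; exists g.
Qed.
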